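(* Suppose that $(M_t)_{t\ge0}$ and $(N_t)_{t\ge0}$ are continuous martingales (with respect to the same filtration) satisfying the following hypotheses almost surely: (1) $[M]_t=[N]_t$ for all $t\ge0$; (2) $[M,N]_t=0$ for all $t\ge0$; (3) $M_t\ge0$ for all $t\ge0$; (4) $\lim_{t\to\infty}M_t=0$; (5) $N_0=0$. Then $N_t$ converges almost surely to a $\mathrm{Cauchy}(M_0)$-distributed limit as $t\to\infty$.
   Context: $[M]$ and $[N]$ denote quadratic variation processes and $[M,N]$ the quadratic covariation process. $\mathrm{Cauchy}(c)$ is the law of $c$ times a standard Cauchy random variable: density $x\mapsto\frac1{\pi c(1+(x/c)^2)}$ for $c>0$, and the point mass at the origin for $c=0$. *)

(* Defs.v *)
From HB Require Import structures.
From mathcomp Require Import all_boot all_order all_algebra.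
From mathcomp Require Import all_classical all_reals all_analysis.
From mathcomp Require Import measurable_realfun.

Set Implicit Arguments.
Unset Strict Implicit.
Unset Printing Implicit Defensive.

Import Order.TTheory GRing.Theory Num.Theory.
Import numFieldNormedType.Exports.

Local Open Scope classical_set_scope.
Local Open Scope ring_scope.

(* Stochastic processes are families X : R -> {RV P >-> R}; the time set is
   [0, +oo[, and the values at negative times are never used. *)

Section processes.
Context (d : measure_display) (T : measurableType d) (R : realType).
Variable P : probability T R.

(* No completeness or right-continuity is assumed. *)
Definition is_filtration (F : R -> set (set T)) : Prop :=
  (forall t, 0 <= t -> sigma_algebra setT (F t) /\ F t `<=` measurable) /\
  (forall s t, 0 <= s -> s <= t -> F s `<=` F t).

Definition measurable_wrt (G : set (set T)) (Z : {RV P >-> R}) : Prop :=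
  preimage_set_system setT Z measurable `<=` G.

Definition integrable_RV (Z : {RV P >-> R}) : Prop :=
  P.-integrable setT (EFin \o Z).

(* Z is a version of E[Y | G] *)
Definition is_cond_expectation (G : set (set T)) (Y Z : {RV P >-> R}) : Prop :=
  [/\ measurable_wrt G Z, integrable_RV Z &
      forall A, G A ->
        (\int[P]_(w in A) (Z w)%:E = \int[P]_(w in A) (Y w)%:E)%E].

Definition is_martingale (F : R -> set (set T)) (X : R -> {RV P >-> R}) : Prop :=
  [/\ forall t, 0 <= t -> measurable_wrt (F t) (X t),
      forall t, 0 <= t -> integrable_RV (X t) &
      forall s t, 0 <= s -> s <= t -> is_cond_expectation (F s) (X t) (X s)].

Definition as_continuous (X : R -> {RV P >-> R}) : Prop :=
  \forall w \ae P, {within `[0, +oo[, continuous (fun t => X t w)}.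

Definition is_continuous_martingale (F : R -> set (set T))
    (X : R -> {RV P >-> R}) : Prop :=
  is_martingale F X /\ as_continuous X.

(* As for itv_partition 0 t s, the list s omits the left endpoint 0: the points
   of the subdivision are 0 :: s. *)
Definition covariation_sum (X Y : R -> {RV P >-> R}) (s : seq R) (w : T) : R :=
  let p := nth 0 (0 :: s) in
  \sum_(0 <= k < size s)
     (X (p k.+1) w - X (p k) w) * (Y (p k.+1) w - Y (p k) w).

Definition mesh (s : seq R) : R :=
  let p := nth 0 (0 :: s) in
  \big[Num.max/0]_(0 <= k < size s) (p k.+1 - p k).

(* Q is a version of [X, Y]: Q has a.s. continuous paths and, for each t, the
   sums over subdivisions of [0, t] converge in probability to Q t as the mesh
   tends to 0. This determines Q on [0, +oo[ up to indistinguishability. *)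
Definition is_quadratic_covariation (X Y Q : R -> {RV P >-> R}) : Prop :=
  as_continuous Q /\
  forall t, 0 <= t -> forall e r : R, 0 < e -> 0 < r ->
    exists2 delta : R, 0 < delta &
      forall s, itv_partition 0 t s -> mesh s < delta ->
        (P [set w | (e <= `|covariation_sum X Y s w - Q t w|)%R] < r%:E)%E.

Definition is_quadratic_variation (X Q : R -> {RV P >-> R}) : Prop :=
  is_quadratic_covariation X X Q.

(* K is a regular conditional law of Z given X. *)
Definition is_cond_law (X Z : {RV P >-> R}) (K : R -> set R -> \bar R) : Prop :=
  (forall B : set R, measurable B -> measurable_fun [set: R] (K ^~ B)) /\
  forall A B : set R, measurable A -> measurable B ->
    P ((X @^-1` A) `&` (Z @^-1` B)) = (\int[P]_(w in X @^-1` A) K (X w) B)%E.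

End processes.

Section cauchy.
Context (R : realType).

Definition cauchy_pdf (c x : R) : R := (pi * c * (1 + (x / c) ^+ 2))^-1.

(* Only meaningful for c >= 0; the point mass is also used for c < 0. *)
Definition cauchy_law (c : R) (B : set R) : \bar R :=
  if 0 < c then (\int[lebesgue_measure]_(x in B) (cauchy_pdf c x)%:E)%E
  else \d_(0 : R) B.

End cauchy.

(* Main.v *)
Require Import Defs.
From HB Require Import structures.
From mathcomp Require Import all_boot all_order all_algebra.
From mathcomp Require Import all_classical all_reals all_analysis.
From mathcomp Require Import measurable_realfun.
From mathcomp Require Import ring lra.

Import Order.TTheory GRing.Theory Num.Theory.
Import numFieldNormedType.Exports.

Local Open Scope classical_set_scope.
Local Open Scope ring_scope.

(** The function u_(a,e)(x, y) = atan ((x - a) / (y + e)) is bounded and harmonic on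
    the half-plane y >= 0, with bounded derivatives.  Since [M] = [N] and [M, N] = 0,
    the second order terms of u(N, M) cancel, so that u(N_t, M_t) is a bounded
    martingale.  No stochastic integral is used: along a fine dyadic subdivision the
    sum of the first order Taylor terms is an exact discrete martingale, the
    remainders are uniformly small in probability because the covariation sums
    converge, and stopping when |N| + |M| or the transform becomes large gives
    enough uniform integrability to pass to the limit in expectations.

    A bounded martingale converges almost surely (energy estimate and Doob's maximal
    inequality).  As M -> 0, the angle u_(0,1)(N, M) determines lim N, except that N
    might escape to infinity, which the martingales u_(a,1) with a -> +-oo exclude.
    Finally E[u_(a,e)(N_oo, 0) ; A] = E[u_(a,e)(0, M_0) ; A] for A in F_0.  With
    a_k = a - 1/k and e_k = 1/k^2 the left side tends to an affine function of
    P(A, N_oo >= a) and the right side to that of E[Cauchy(M_0)([a, +oo[) ; A]. *)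

Set Implicit Arguments.
Unset Strict Implicit.
Unset Printing Implicit Defensive.

(** * Expectations and discrete martingales *)

(** The increments of [M] and [N] are only integrable and the covariation sums converge only in
    probability, so the summed Taylor remainders cannot be passed to the limit in mean directly.
    Boundedness of the harmonic function repairs this. Off a rare event the first order sum lies
    within 1 of a bounded quantity, so stopping it just above that bound changes nothing there. At
    the exit the overshoot is a single step, at most a multiple of |N| + |M| at its two endpoints;
    the submartingale property moves this to the terminal time t, where integrability of |N_t| +
    |M_t| suffices.

    The second order sums are handled on two scales. Coarse blocks are short enough to freeze the
    second derivatives. Inside a block the sums of dN^2 - dM^2 and of dN dM are small once the fine
    mesh is. The fine mesh is chosen last, because the block errors add up over the number of
    blocks. *)

Section expectation.
Context d (T : measurableType d) (R : realType) (P : probability T R).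
Implicit Types (f g h : T -> R) (A : set T).

Definition intble f := P.-integrable setT (EFin \o f).
Definition expect f : R := (\int[P]_w f w)%R.

Lemma eq_expect f g : f =1 g -> expect f = expect g.
Proof. by move=> fg; congr expect; apply/funext. Qed.

Lemma intble_measurable f : intble f -> measurable_fun setT f.
Proof. by move=> /measurable_int/measurable_EFinP. Qed.

Lemma intble_bounded f (c : R) : measurable_fun setT f ->
  (forall w, `|f w| <= c) -> intble f.
Proof.
move=> mf fc; apply: measurable_bounded_integrable => //.
  by rewrite (le_lt_trans (probability_le1 _ _))// ltry.
exists c; split; first exact: num_real.
by move=> x cx w _; apply: (le_trans (fc w)); exact: ltW.
Qed.

Lemma intble_cst (c : R) : intble (cst c).
Proof. exact: (@intble_bounded _ `|c|). Qed.

Lemma intbleD f g : intble f -> intble g -> intble (fun w => f w + g w).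
Proof. by move=> /integrableD h /h; exact. Qed.

Lemma intbleB f g : intble f -> intble g -> intble (fun w => f w - g w).
Proof. by move=> /integrableB h /h; exact. Qed.

Lemma intbleM f h (c : R) : intble f -> measurable_fun setT h ->
  (forall w, `|h w| <= c) -> intble (fun w => h w * f w).
Proof.
move=> fi mh hc; apply: (@integrableMr _ _ _ _ _ measurableT h (EFin \o f)) => //.
exists c; split; first exact: num_real.
by move=> x cx w _; apply: (le_trans (hc w)); exact: ltW.
Qed.

Lemma intbleZ f (c : R) : intble f -> intble (fun w => c * f w).
Proof. by move=> fi; apply: (@intbleM f (cst c) `|c|). Qed.

Lemma intble_norm f : intble f -> intble (fun w => `|f w|).
Proof. by move=> fi; exact: integrable_norm. Qed.

Lemma intble_sum (I : Type) (s : seq I) (F : I -> T -> R) :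
  (forall i, intble (F i)) -> intble (fun w => \sum_(i <- s) F i w).
Proof.
move=> Fi; elim: s => [|i s IH].
  have -> : (fun w => \sum_(i <- [::]) F i w) = cst 0.
    by apply/funext => w; rewrite big_nil.
  exact: intble_cst.
have -> : (fun w => \sum_(j <- i :: s) F j w) =
          (fun w => F i w + \sum_(j <- s) F j w).
  by apply/funext => w; rewrite big_cons.
exact: intbleD.
Qed.

Lemma normr_indic A w : `|\1_A w : R| <= 1.
Proof. by rewrite indicE ger0_norm// ?lern1 ?ler0n// leq_b1. Qed.

Lemma intble_indicM A f : measurable A -> intble f ->
  intble (fun w => \1_A w * f w).
Proof.
by move=> mA fi; apply: (@intbleM f _ 1) => // w; exact: normr_indic.
Qed.

Lemma intble_indic A : measurable A -> intble (\1_A).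
Proof. by move=> mA; apply: (@intble_bounded _ 1) => // w; exact: normr_indic. Qed.

Lemma le_intble f g : measurable_fun setT f -> intble g ->
  (forall w, `|f w| <= g w) -> intble f.
Proof.
move=> mf gi fg; apply: le_integrable gi => //; first exact/measurable_EFinP.
by move=> w _ /=; rewrite lee_fin (le_trans (fg w))// ler_norm.
Qed.

Lemma expectD f g : intble f -> intble g ->
  expect (fun w => f w + g w) = expect f + expect g.
Proof. by move=> fi gi; rewrite /expect RintegralD. Qed.

Lemma expectB f g : intble f -> intble g ->
  expect (fun w => f w - g w) = expect f - expect g.
Proof. by move=> fi gi; rewrite /expect RintegralB. Qed.

Lemma expectZ f c : intble f -> expect (fun w => c * f w) = c * expect f.
Proof. by move=> fi; rewrite /expect RintegralZl. Qed.

Lemma expect_cst c : expect (cst c) = c.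
Proof.
rewrite /expect Rintegral_cst// -[RHS]mulr1 -[1 in RHS]/(fine 1%E); congr (_ * fine _).
exact: probability_setT.
Qed.

Lemma expect_sum (I : Type) (s : seq I) (F : I -> T -> R) :
  (forall i, intble (F i)) ->
  expect (fun w => \sum_(i <- s) F i w) = \sum_(i <- s) expect (F i).
Proof.
move=> Fi; elim: s => [|i s IH].
  rewrite big_nil -[RHS](expect_cst 0); apply: eq_expect => w.
  by rewrite big_nil.
rewrite big_cons -IH -expectD//; last exact: intble_sum.
by apply: eq_expect => w; rewrite big_cons.
Qed.

Lemma le_expect f g : intble f -> intble g -> (forall w, f w <= g w) ->
  expect f <= expect g.
Proof. by move=> fi gi fg; apply: le_Rintegral. Qed.

Lemma expect_ge0 f : (forall w, 0 <= f w) -> 0 <= expect f.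
Proof. by move=> f0; apply: Rintegral_ge0. Qed.

Lemma le_normr_expect f : intble f -> `|expect f| <= expect (fun w => `|f w|).
Proof. by move=> fi; apply: le_normr_Rintegral. Qed.

Lemma expect_indic A : measurable A -> expect \1_A = fine (P A).
Proof. by move=> mA; rewrite /expect /Rintegral integral_indic// setIT. Qed.

Lemma ae_eq_expect f g : measurable_fun setT f -> measurable_fun setT g ->
  (\forall w \ae P, f w = g w) -> expect f = expect g.
Proof.
move=> mf mg fg; congr fine; apply: ae_eq_integral => //.
- exact/measurable_EFinP.
- exact/measurable_EFinP.
- by apply: filterS fg => w /= -> _.
Qed.

Lemma fineP_ge0 A : 0 <= fine (P A).
Proof. exact: fine_ge0. Qed.

Lemma fineP_fin A : measurable A -> (fine (P A))%:E = P A.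
Proof. by move=> mA; rewrite fineK// fin_num_measure. Qed.

End expectation.
Arguments expect {d T R} P f.
Arguments intble {d T R} P f.

Section expectation_on_sets.
Context d (T : measurableType d) (R : realType) (P : probability T R).

Lemma expect_indicM (A : set T) (f : T -> R) : measurable A ->
  expect P (fun w => \1_A w * f w) = (\int[P]_(w in A) f w)%R.
Proof.
move=> mA; rewrite [RHS]Rintegral_mkcond patch_indic.
by apply: eq_expect => w; rewrite mulrC.
Qed.

Lemma intble_abs_continuous (f : T -> R) (e : R) : intble P f ->
  (forall w, 0 <= f w) -> 0 < e ->
  exists2 dl : R, 0 < dl & forall E, measurable E -> fine (P E) < dl ->
    expect P (fun w => \1_E w * f w) <= e.
Proof.
move=> fi f0 e0; have [dl [dl0 h]] := integral_normr_continuous fi e0.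
exists dl => // E mE PE; rewrite expect_indicM//.
rewrite (_ : (\int[P]_(w in E) f w)%R = (\int[P]_(w in E) `|f w|)%R).
  by apply/ltW/h => //; move: PE; rewrite -lte_fin fineP_fin.
by apply: eq_Rintegral => w _; rewrite ger0_norm.
Qed.

End expectation_on_sets.

(** * Functions measurable with respect to a sub-sigma-algebra *)

Section adapted.
Context d (T : measurableType d) (R : realType) (P : probability T R).
Implicit Types (G : set (set T)) (f g h : T -> R) (A : set T).

(** Phrased through [g_sigma_algebraType G], so that the closure of measurable functions under sums,
    products and composition applies verbatim to adapted functions. *)
Definition adapted_to G f :=
  measurable_fun [set: g_sigma_algebraType G] (f : g_sigma_algebraType G -> R).

Lemma measurable_gE G A : sigma_algebra setT G ->
  measurable (A : set (g_sigma_algebraType G)) = G A.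
Proof.
by move=> sG; rewrite -[in RHS](measurable_g_measurableTypeE sG).
Qed.

Lemma measurable_wrt_adapted G (Z : {RV P >-> R}) : sigma_algebra setT G ->
  measurable_wrt G Z -> adapted_to G Z.
Proof.
move=> sG mZ _ B mB; rewrite measurable_gE//; apply: mZ.
by exists B.
Qed.

Lemma adapted_preimage G f B : sigma_algebra setT G -> adapted_to G f ->
  measurable B -> G (f @^-1` B).
Proof.
move=> sG mf mB; rewrite -measurable_gE// -[X in measurable X]setTI.
exact: (mf).
Qed.

Lemma adaptedS G G' f : sigma_algebra setT G -> sigma_algebra setT G' ->
  G `<=` G' -> adapted_to G f -> adapted_to G' f.
Proof.
move=> sG sG' GG' mf mT B mB; rewrite setTI measurable_gE//; apply: GG'.
exact: adapted_preimage.
Qed.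

Lemma adapted_measurable G f : sigma_algebra setT G -> G `<=` measurable ->
  adapted_to G f -> measurable_fun setT f.
Proof.
by move=> sG Gm mf _ B mB; rewrite setTI; apply: Gm; exact: adapted_preimage.
Qed.

Lemma indic_adapted G A : sigma_algebra setT G -> G A -> adapted_to G \1_A.
Proof.
by move=> sG GA; apply: measurable_indic; rewrite measurable_gE.
Qed.

(** The sum [S] counts the integers in [1, m] below [x], so it is the floor of [x] capped at [m].
    The third clause only serves to carry the induction. *)
Lemma staircase (x : R) m : 0 <= x ->
  let S := \sum_(1 <= j < m.+1) (j%:R <= x)%R%:R : R in
  [/\ S <= x, S <= m%:R, m%:R <= x -> S = m%:R & x <= m%:R -> x <= S + 1].
Proof.
move=> x0 /=; elim: m => [|m [h1 h2 h3 h4]].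
  by rewrite big_geq//; split => // xle0; rewrite add0r (le_trans xle0).
rewrite big_nat_recr//=; have e : m.+1%:R = m%:R + 1 :> R by rewrite -natr1.
case: (leP m.+1%:R x) => mx /=.
  have mx' : m%:R <= x by rewrite (le_trans _ mx)// ler_nat.
  by rewrite (h3 mx') -e; split => // xm; lra.
rewrite addr0; split => //.
- by rewrite (le_trans h2)// ler_nat.
- move=> _; have [mx'|mx'] := leP m%:R x; last by apply: h4; exact: ltW.
  by rewrite h3// -e ltW.
Qed.

(* Uniform approximation of [h] by a staircase of G-measurable indicators. *)
Lemma expect_adaptedM_eq0 G h f (c : R) : sigma_algebra setT G ->
    G `<=` measurable -> adapted_to G h -> (forall w, `|h w| <= c) ->
    intble P f -> (forall A, G A -> expect P (fun w => \1_A w * f w) = 0) ->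
  expect P (fun w => h w * f w) = 0.
Proof.
move=> sG Gm mh hc fi f0.
wlog c0 : c hc / 0 < c.
  move=> H; apply: (H (`|c| + 1)); last by rewrite ltr_wpDl.
  by move=> w; rewrite (le_trans (hc w))// (le_trans (ler_norm _))// lerDl.
have mh' := adapted_measurable sG Gm mh.
set K := expect P (fun w => `|f w|).
have K0 : 0 <= K by exact: expect_ge0.
suff H : forall m : nat, `|expect P (fun w => h w * f w)| <=
    (c + c) * K * m.+1%:R^-1.
  apply/eqP; rewrite -normr_le0; apply/ler_addgt0Pr => e e0; rewrite add0r.
  have /ltr_add_invr[m] : 0 < e / ((c + c) * K + 1).
    by rewrite divr_gt0// ltr_wpDl// mulr_ge0// addr_ge0// ltW.
  rewrite add0r => me; apply: (le_trans (H m)).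
  have p0 : 0 <= (c + c) * K by rewrite mulr_ge0// addr_ge0// ltW.
  apply: (@le_trans _ _ (((c + c) * K + 1) * (e / ((c + c) * K + 1)))).
    by apply: ler_pM => //; rewrite ?invr_ge0// ?lerDl// ltW.
  by rewrite mulrC divfK// gt_eqF// ltr_wpDl.
(* The range [-c, c] of [h] is cut into [m.+1] slices of height [e]; [A j] is the event that [h]
   lies above the j-th cut. *)
move=> m; set e := (c + c) / m.+1%:R.
have e0 : 0 < e by rewrite divr_gt0// addr_gt0.
pose A j := [set w | j%:R <= (h w + c) / e].
have GA j : G (A j).
  rewrite (_ : A j = h @^-1` `[j%:R * e - c, +oo[); last first.
    apply/seteqP; split => w /=; rewrite /A/= in_itv/= andbT ler_pdivlMr//; lra.
  exact: adapted_preimage.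
have mA j : measurable (A j) by exact: Gm.
pose s w : R := \sum_(1 <= j < m.+2) \1_(A j) w.
have sE w : s w = \sum_(1 <= j < m.+2) (j%:R <= (h w + c) / e)%R%:R.
  apply: eq_bigr => j _; rewrite indicE; congr ((_ : bool)%:R : R).
  by apply/idP/idP; rewrite /A inE.
have hs w : `|h w - (s w * e - c)| <= e.
  have /andP[h1 h2] : - c <= h w <= c by rewrite -ler_norml.
  have x0 : 0 <= (h w + c) / e by rewrite divr_ge0// ?(ltW e0)//; lra.
  have [h3 _ _ h4] := staircase m.+1 x0.
  rewrite -sE in h3 h4.
  have xm : (h w + c) / e <= m.+1%:R.
    rewrite ler_pdivrMr// /e mulrC divfK ?pnatr_eq0//; lra.
  move: h3 (h4 xm); rewrite ler_pdivlMr// ler_pdivrMr// mulrDl mul1r => h3' h4'.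
  rewrite ler_norml; apply/andP; split; lra.
have ms : measurable_fun setT s by apply: measurable_sum => j; exact: measurable_indic.
have si : intble P s by apply: intble_sum => j; exact: intble_indic.
have sfi : intble P (fun w => s w * f w).
  apply: (intbleM (c := m.+1%:R)) => // w.
  rewrite ger0_norm ?sumr_ge0// (le_trans (ler_sum _ (G := fun=> 1) _))//.
  by rewrite big_const_nat iter_addr addr0 subSS subn0.
have sf0 : expect P (fun w => s w * f w) = 0.
  rewrite (_ : (fun w => _) =
      (fun w => \sum_(1 <= j < m.+2) \1_(A j) w * f w)); last first.
    by apply/funext => w; rewrite mulr_suml.
  rewrite expect_sum; last by move=> j; exact: intble_indicM.
  by rewrite big1// => j _; exact: f0.
(* The approximant is [s * e - c]: its constant part is orthogonal to [f] by the case A = setT. *)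
have f00 : expect P f = 0.
  rewrite -[RHS](f0 setT); last first.
    by case: sG => g0 gc _; rewrite -(setD0 setT); exact: gc.
  by apply: eq_expect => w; rewrite indicE in_setT mul1r.
have Hi : intble P (fun w => (h w - (s w * e - c)) * f w).
  apply: (intbleM (c := e)) => //.
  by apply: measurable_funB => //; apply: measurable_funB => //;
    exact: measurable_funM.
have hfE : expect P (fun w => h w * f w) =
    expect P (fun w => (h w - (s w * e - c)) * f w).
  rewrite (_ : (fun w => h w * f w) = (fun w =>
    (h w - (s w * e - c)) * f w + (e * (s w * f w) - c * f w))); last first.
    by apply/funext => w; ring.
  rewrite expectD//; last by apply: intbleB; exact: intbleZ.
  rewrite expectB; [|exact: intbleZ|exact: intbleZ].
  by rewrite !expectZ// sf0 f00 !mulr0 subr0 addr0.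
rewrite hfE.
apply: (le_trans (le_normr_expect Hi)).
rewrite (_ : _ * K * _ = e * K); last by rewrite /e; ring.
rewrite -expectZ; last exact: intble_norm.
apply: le_expect; first exact: intble_norm.
  by apply: intbleZ; exact: intble_norm.
by move=> w; rewrite normrM ler_wpM2r.
Qed.

End adapted.

Lemma sum_indic_trivI (T : Type) (R : realType) (E : nat -> set T) n (w : T)
    (B : set T) :
  (forall i j, E i w -> E j w -> i = j) ->
  (B w <-> exists2 i, (i < n)%N & E i w) ->
  \sum_(i < n) \1_(E i) w = \1_B w :> R.
Proof.
move=> Etriv Bw; rewrite [RHS]indicE.
have [wB|wB] := boolP (w \in B).
  have /Bw[i ni Eiw] := set_mem wB.
  rewrite (bigD1 (Ordinal ni))//= big1 ?addr0 ?indicE ?mem_set// => j.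
  rewrite -val_eqE/= => ji; rewrite indicE memNset// => /(Etriv _ _ Eiw) ij.
  by rewrite ij eqxx in ji.
rewrite big1// => i _; rewrite indicE memNset// => Ei.
by move/negP: wB; apply; apply/mem_set/Bw; exists i.
Qed.

(** * Discrete submartingales and Doob's maximal inequality *)

Section discrete_martingale.
Context d (T : measurableType d) (R : realType) (P : probability T R).
Variable G : nat -> set (set T).
Hypothesis sG : forall i, sigma_algebra setT (G i).
Hypothesis Gm : forall i, G i `<=` measurable.
Hypothesis Gmono : forall i j, (i <= j)%N -> G i `<=` G j.
Implicit Types (X W : nat -> T -> R).

(** Every index is compared with the terminal one only: a stopped value is always replaced by the
    value at [n]. *)
Definition closed_submart W n := forall i A, (i <= n)%N -> G i A ->
  expect P (fun w => \1_A w * W i w) <= expect P (fun w => \1_A w * W n w).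

Definition closed_mart X n := forall i A, (i <= n)%N -> G i A ->
  expect P (fun w => \1_A w * X i w) = expect P (fun w => \1_A w * X n w).

Lemma G_setI i A B : G i A -> G i B -> G i (A `&` B).
Proof.
move=> GA GB; rewrite -measurable_gE//.
by apply: measurableI; rewrite measurable_gE.
Qed.

(** Split [A] by the sign of [X i] into two events of [G i]. On each the martingale property
    replaces [X i] by [X n], and both [X n] and [- X n] are at most [|X n|]. *)
Lemma closed_submart_norm X n : (forall i, intble P (X i)) ->
  (forall i, adapted_to (G i) (X i)) -> closed_mart X n ->
  closed_submart (fun i w => `|X i w|) n.
Proof.
move=> Xi Xa Xm i A ni GA.
pose Ap := A `&` X i @^-1` `[0, +oo[; pose An := A `&` X i @^-1` `]-oo, 0[.
have GAp : G i Ap by apply: G_setI => //; exact: adapted_preimage.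
have GAn : G i An by apply: G_setI => //; exact: adapted_preimage.
have mAp := Gm GAp; have mAn := Gm GAn; have mA := Gm GA.
have E1 w : \1_A w * `|X i w| = \1_Ap w * X i w - \1_An w * X i w.
  rewrite !indicE /Ap /An !in_setI.
  case: (w \in A); rewrite /= ?mul0r ?subr0//.
  have [x0|x0] := ltP (X i w) 0.
    rewrite [w \in _]memNset ?mem_set/= ?in_itv/= ?andbT ?x0 ?leNgt ?x0//.
    by rewrite ltr0_norm//; lra.
  rewrite [w \in _]mem_set ?memNset/= ?in_itv/= ?andbT ?ltNge ?x0//.
  by rewrite ger0_norm//; lra.
rewrite (eq_expect _ E1) expectB; [|exact: intble_indicM|exact: intble_indicM].
rewrite !Xm// -expectB; [|exact: intble_indicM|exact: intble_indicM].
apply: le_expect => //.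
- by apply: intbleB; exact: intble_indicM.
- by apply: intble_indicM => //; exact: intble_norm.
move=> w; rewrite !indicE /Ap /An !in_setI.
case: (w \in A); rewrite /= ?mul0r ?subr0// ?mul1r.
have [x0|x0] := ltP (X i w) 0.
  rewrite [w \in _]memNset ?mem_set/= ?in_itv/= ?andbT ?x0 ?leNgt ?x0//.
  by have := ler_norm (- X n w); rewrite normrN/=; lra.
rewrite [w \in _]mem_set ?memNset/= ?in_itv/= ?andbT ?ltNge ?x0//.
by have := ler_norm (X n w); rewrite /=; lra.
Qed.

Lemma closed_submartD X W n : (forall i, intble P (X i)) ->
  (forall i, intble P (W i)) -> closed_submart X n -> closed_submart W n ->
  closed_submart (fun i w => X i w + W i w) n.
Proof.
move=> Xi Wi Xs Ws i A ni GA; have mA := Gm GA.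
rewrite (eq_expect _ (fun w => mulrDr (\1_A w) (X i w) (W i w))).
rewrite (eq_expect _ (fun w => mulrDr (\1_A w) (X n w) (W n w))).
rewrite !expectD; try exact: intble_indicM.
by apply: lerD; [exact: Xs|exact: Ws].
Qed.

(** Optional stopping, with the stopping time encoded by the events [E i] of stopping at [i]: on
    each of them [W i] is replaced by [W n], and their indicators sum to at most that of [B]. *)
Lemma submart_stopped_le W n (E : nat -> set T) B :
  (forall i, intble P (W i)) -> (forall w, 0 <= W n w) -> closed_submart W n ->
  (forall i, (i <= n)%N -> G i (E i)) -> measurable B ->
  (forall w, \sum_(i < n.+1) \1_(E i) w <= \1_B w :> R) ->
  \sum_(i < n.+1) expect P (fun w => \1_(E i) w * W i w)
    <= expect P (fun w => \1_B w * W n w).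
Proof.
move=> Wi W0 Ws GE mB EB.
have mE (i : 'I_n.+1) : measurable (E i) by apply/Gm/(GE i); rewrite -ltnS.
apply: (@le_trans _ _ (\sum_(i < n.+1) expect P (fun w => \1_(E i) w * W n w))).
  by apply: ler_sum => i _; apply: Ws; [|apply: GE]; rewrite -ltnS.
rewrite -expect_sum; last by move=> i; exact: intble_indicM.
apply: le_expect; first by apply: intble_sum => i; exact: intble_indicM.
  exact: intble_indicM.
by move=> w; rewrite -mulr_suml ler_wpM2r.
Qed.

Definition exceeds W (K : R) n := [set w | exists2 i, (i <= n)%N & K < W i w].

Definition first_exceeds W (K : R) i :=
  [set w | K < W i w /\ forall j, (j < i)%N -> W j w <= K].

Lemma first_exceedsP W K n w :
  exceeds W K n w <-> exists2 i, (i < n.+1)%N & first_exceeds W K i w.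
Proof.
split=> [[i ni Ki]|[i ni [Ki _]]]; last by exists i.
have ex : exists i, K < W i w by exists i.
exists (ex_minn ex).
  by case: ex_minnP => m _ /(_ _ Ki) mi; exact: leq_ltn_trans mi _.
case: ex_minnP => m Km mmin; split => // j jm; rewrite leNgt; apply/negP => Kj.
by have := mmin _ Kj; rewrite leqNgt jm.
Qed.

Lemma first_exceeds_inj W K i j w :
  first_exceeds W K i w -> first_exceeds W K j w -> i = j.
Proof.
move=> [Ki Kli] [Kj Klj]; case: (ltngtP i j) => // ij.
  by have := lt_le_trans Ki (Klj _ ij); rewrite ltxx.
by have := lt_le_trans Kj (Kli _ ij); rewrite ltxx.
Qed.

Lemma G_first_exceeds W K i : (forall i, adapted_to (G i) (W i)) ->
  G i (first_exceeds W K i).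
Proof.
move=> Wa; rewrite (_ : first_exceeds _ _ _ =
    W i @^-1` `]K, +oo[ `&` \bigcap_(j in [set j | (j < i)%N]) W j @^-1` `]-oo, K]).
  apply: G_setI; first exact: adapted_preimage.
  rewrite -measurable_gE//; apply: bigcap_measurableType => j /= ji.
  by rewrite measurable_gE//; apply: (Gmono (ltnW ji)); exact: adapted_preimage.
apply/seteqP; split => w /=.
  by move=> [h1 h2]; split => [|j /= /h2]; rewrite ?in_itv/= ?andbT.
by rewrite in_itv/= andbT => -[h1 h2]; split => // j /h2/=; rewrite in_itv.
Qed.

Lemma measurable_exceeds W K n : (forall i, adapted_to (G i) (W i)) ->
  measurable (exceeds W K n).
Proof.
move=> Wa; rewrite (_ : exceeds _ _ _ =
    \bigcup_(i in [set i | (i <= n)%N]) W i @^-1` `]K, +oo[).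
  apply: bigcup_measurable => i _; apply: (@Gm i); exact: adapted_preimage.
by apply/seteqP; split => w /= [i ni h]; exists i => //;
  move: h; rewrite /= in_itv/= andbT.
Qed.

(** The first passage events partition [exceeds W K n], and [W i] is larger than [K] on the i-th of
    them; [submart_stopped_le] then moves all these values to the index [n]. *)
Lemma doob_maximal W K n : (forall i, intble P (W i)) ->
  (forall i, adapted_to (G i) (W i)) -> (forall w, 0 <= W n w) ->
  closed_submart W n ->
  K * fine (P (exceeds W K n)) <= expect P (fun w => \1_(exceeds W K n) w * W n w).
Proof.
move=> Wi Wa W0 Ws.
have mB := measurable_exceeds K n Wa.
have EB w : \sum_(i < n.+1) \1_(first_exceeds W K i) w =
    \1_(exceeds W K n) w :> R.
  apply: sum_indic_trivI; last exact: first_exceedsP.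
  by move=> i j; exact: first_exceeds_inj.
have := @submart_stopped_le W n (first_exceeds W K) (exceeds W K n) Wi W0 Ws.
move=> /(_ _ mB) h; apply: le_trans (h _ _); last first.
- by move=> w; rewrite EB.
- by move=> i ni; exact: G_first_exceeds.
have mE i : measurable (first_exceeds W K i).
  by apply: (@Gm i); exact: G_first_exceeds.
rewrite -expect_indic// -expectZ; last exact: intble_indic.
rewrite -expect_sum; last by move=> i; exact: intble_indicM.
apply: le_expect.
- by apply: intbleZ; exact: intble_indic.
- by apply: intble_sum => i; exact: intble_indicM.
move=> w; rewrite -EB mulr_sumr; apply: ler_sum => i _.
rewrite indicE; case: (boolP (w \in _)) => [|_]; last by rewrite mulr0 mul0r.
by rewrite inE mulr1 mul1r => -[/ltW].
Qed.

End discrete_martingale.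

(** * Stopped martingale transforms and the basic estimate in expectation *)

Section stopped_transform.
Context d (T : measurableType d) (R : realType) (P : probability T R).
Variable G : nat -> set (set T).
Hypothesis sG : forall i, sigma_algebra setT (G i).
Hypothesis Gm : forall i, G i `<=` measurable.
Hypothesis Gmono : forall i j, (i <= j)%N -> G i `<=` G j.
Variables (X Y U p q : nat -> T -> R) (n : nat) (b c : R).
Hypothesis Xi : forall i, intble P (X i).
Hypothesis Yi : forall i, intble P (Y i).
Hypothesis Xa : forall i, adapted_to (G i) (X i).
Hypothesis Ya : forall i, adapted_to (G i) (Y i).
Hypothesis Xm : closed_mart P G X n.
Hypothesis Ym : closed_mart P G Y n.
Hypothesis pa : forall i, adapted_to (G i) (p i).
Hypothesis qa : forall i, adapted_to (G i) (q i).
Hypothesis pc : forall i w, `|p i w| <= c.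
Hypothesis qc : forall i w, `|q i w| <= c.
Hypothesis mU : forall i, measurable_fun setT (U i).
Hypothesis Ub : forall i w, `|U i w| <= b.

Let W i w : R := `|X i w| + `|Y i w|.

(** Discrete counterpart of p dX + q dY. The coefficients are taken at the left endpoint, which
    makes each step a martingale difference. *)
Definition transform_step k w : R :=
  p k w * (X k.+1 w - X k w) + q k w * (Y k.+1 w - Y k w).

Definition transform k w : R := \sum_(j < k) transform_step j w.

Local Notation step := transform_step.
Local Notation D := transform.

Lemma transform_adapted k : adapted_to (G k) (D k).
Proof.
apply: measurable_sum => j; have jk := ltn_ord j.
have l i (f : T -> R) : (i <= k)%N -> adapted_to (G i) f -> adapted_to (G k) f.
  by move=> ik; apply: adaptedS => //; exact: Gmono.
apply: measurable_funD; apply: measurable_funM.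
- exact: l _ _ (ltnW jk) (@pa j).
- by apply: measurable_funB; [exact: l _ _ jk (@Xa _)|exact: l _ _ (ltnW jk) (@Xa _)].
- exact: l _ _ (ltnW jk) (@qa j).
- by apply: measurable_funB; [exact: l _ _ jk (@Ya _)|exact: l _ _ (ltnW jk) (@Ya _)].
Qed.

Lemma intble_step k : intble P (step k).
Proof.
apply: intbleD; apply: (intbleM (c := c)) => //; try exact: intbleB.
  exact: (adapted_measurable (sG k) (@Gm k)).
exact: (adapted_measurable (sG k) (@Gm k)).
Qed.

Lemma closed_mart_diff Z k A : closed_mart P G Z n -> (forall i, intble P (Z i)) ->
  (k < n)%N -> G k A -> expect P (fun w => \1_A w * (Z k.+1 w - Z k w)) = 0.
Proof.
move=> Zm Zi kn GA; have mA := @Gm _ _ GA.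
rewrite (eq_expect _ (fun w => mulrBr (\1_A w) (Z k.+1 w) (Z k w))).
rewrite expectB; [|exact: intble_indicM|exact: intble_indicM].
by rewrite (Zm k.+1)//; [rewrite (Zm k) ?subrr// ltnW|exact: Gmono GA].
Qed.

(** The factors [\1_A * p k] and [\1_A * q k] are bounded and [G k]-measurable, hence orthogonal to
    the increments of [X] and [Y] from [k] to [k.+1]. *)
Lemma expect_indic_step k A : (k < n)%N -> G k A ->
  expect P (fun w => \1_A w * step k w) = 0.
Proof.
move=> kn GA; have mA := @Gm _ _ GA.
have key Z r : closed_mart P G Z n -> (forall i, intble P (Z i)) ->
    adapted_to (G k) r -> (forall w, `|r w| <= c) ->
    intble P (fun w => (\1_A w * r w) * (Z k.+1 w - Z k w)) /\
    expect P (fun w => (\1_A w * r w) * (Z k.+1 w - Z k w)) = 0.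
  move=> Zm Zi ra rc.
  have hc w : `|\1_A w * r w| <= c.
    by rewrite normrM -[leRHS]mul1r ler_pM// normr_indic.
  have ha : adapted_to (G k) (fun w => \1_A w * r w).
    by apply: measurable_funM => //; exact: indic_adapted.
  split; first apply: (intbleM (c := c)) => //; first exact: intbleB.
    exact: (adapted_measurable (sG k) (@Gm k)).
  apply: (@expect_adaptedM_eq0 _ _ _ _ (G k) _ _ c) => //; first exact: intbleB.
  by move=> B GB; exact: closed_mart_diff.
have [i1 e1] := key X (p k) Xm Xi (@pa k) (pc k).
have [i2 e2] := key Y (q k) Ym Yi (@qa k) (qc k).
rewrite (eq_expect _ (g := fun w => \1_A w * p k w * (X k.+1 w - X k w) +
   \1_A w * q k w * (Y k.+1 w - Y k w))); last by move=> w; rewrite /step; ring.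
by rewrite expectD// e1 e2 addr0.
Qed.

(** The event that step [k] is still taken. It depends on the indices up to [k] only, so cutting the
    sum by it preserves the martingale property. *)
Definition alive (K L : R) k :=
  [set w | forall j, (j <= k)%N -> W j w <= K /\ `|D j w| <= L].

Lemma G_alive K L k : G k (alive K L k).
Proof.
rewrite (_ : alive K L k = \bigcap_(j in [set j | (j <= k)%N])
    (W j @^-1` `]-oo, K] `&` D j @^-1` `[- L, L])).
  rewrite -measurable_gE//; apply: bigcap_measurableType => j /= jk.
  rewrite measurable_gE//; apply: (Gmono jk); apply: G_setI => //;
    apply: adapted_preimage => //; last exact: transform_adapted.
  by apply: measurable_funD; apply: measurableT_comp => //; [exact: Xa|exact: Ya].
by apply/seteqP; split => w /= h j /h /=; rewrite !in_itv/= ler_norml.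
Qed.

Definition stopped_transform K L w : R := \sum_(k < n) \1_(alive K L k) w * step k w.

(* The value at the exit time exceeds [L] by at most one step, which is bounded
   by [2 c K] unless the exit is a passage of [W] above [K]. *)
Lemma stopped_transform_bound K L w : 0 <= K -> 0 <= L ->
  `|stopped_transform K L w| <= L + 2 * c * K +
     c * \sum_(i < n.+1) \1_(first_exceeds W K i) w * W i w /\
  (alive K L n w -> stopped_transform K L w = D n w).
Proof.
move=> K0 L0; have c0 : 0 <= c by rewrite (le_trans _ (pc 0 w)).
have S0 : 0 <= \sum_(i < n.+1) \1_(first_exceeds W K i) w * W i w.
  by apply: sumr_ge0 => i _; rewrite mulr_ge0// /W addr_ge0.
have cS0 := mulr_ge0 c0 S0.
have cK0 := mulr_ge0 c0 K0.
have aliveS j k : (j <= k)%N -> alive K L k w -> alive K L j w.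
  by move=> jk h i ij; apply: h; exact: leq_trans jk.
have E : alive K L n w -> stopped_transform K L w = D n w.
  move=> an; rewrite /stopped_transform /transform; apply: eq_bigr => k _.
  rewrite indicE mem_set ?mul1r//.
  by apply: aliveS an; exact: ltnW.
split => //; have [an|nan] := pselect (alive K L n w).
  by rewrite E//; have [] := an n (leqnn n); lra.
have ex : exists i, `[< ~ alive K L i w >] by exists n; exact/asboolP.
case: (ex_minnP ex) => i /asboolP nai imin.
have ni : (i <= n)%N by apply: imin; exact/asboolP.
have aP k : (k < i)%N -> alive K L k w.
  move=> ki; apply: contrapT => nak.
  by have := imin k (asboolT nak); rewrite leqNgt ki.
(* Here [i] is the first index at which the path is not alive: exactly the steps before [i] are
   taken, and the last of them may leave the allowed region. *)
have -> : stopped_transform K L w = D i w.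
  rewrite /stopped_transform /transform (big_ord_widen _ (fun j => step j w) ni).
  rewrite [RHS]big_mkcond/=; apply: eq_bigr => k _; rewrite indicE.
  case: ltnP => ki; first by rewrite mem_set ?mul1r//; exact: aP.
  by rewrite memNset ?mul0r// => ak; apply: nai; exact: aliveS ak.
case: i => [|i] in ni nai imin aP *.
  by rewrite /transform big_ord0 normr0; lra.
have [Wi Di] := aP i (ltnSn i) i (leqnn i).
have WS : W i.+1 w <= K + \sum_(j < n.+1) \1_(first_exceeds W K j) w * W j w.
  have [WK|WK] := leP (W i.+1 w) K; first lra.
  have f : first_exceeds W K i.+1 w.
    by split => // j ji; have [] := aP j ji j (leqnn j).
  have ni1 : (i.+1 < n.+1)%N by [].
  rewrite (bigD1 (Ordinal ni1))//= indicE mem_set// mul1r.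
  have : 0 <= \sum_(j < n.+1 | j != Ordinal ni1)
      \1_(first_exceeds W K j) w * W j w.
    by apply: sumr_ge0 => j _; rewrite mulr_ge0// /W addr_ge0.
  lra.
have -> : D i.+1 w = D i w + step i w by rewrite /transform big_ord_recr.
apply: (le_trans (ler_normD _ _)).
have : `|step i w| <= c * (W i w + W i.+1 w).
  apply: (le_trans (ler_normD _ _)); rewrite !normrM.
  have h1 := pc i w; have h2 := qc i w.
  have h3 := ler_normB (X i.+1 w) (X i w).
  have h4 := ler_normB (Y i.+1 w) (Y i w).
  apply: (@le_trans _ _ (c * (`|X i.+1 w| + `|X i w|) +
      c * (`|Y i.+1 w| + `|Y i w|))).
    by apply: lerD; apply: ler_pM.
  by rewrite -mulrDr ler_wpM2l// /W; lra.
have : c * (W i w + W i.+1 w) <= c * (2 * K +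
    \sum_(j < n.+1) \1_(first_exceeds W K j) w * W j w).
  by rewrite ler_wpM2l//; lra.
rewrite mulrDr; lra.
Qed.

Let dev k w : R := U k w - U 0 w - D k w.

(** The stopped transform has mean zero on [A], so it may be subtracted from [U n - U 0]. Off [B1]
    and [Bd] it equals [D n] and the difference is at most [e]. On [B1] or [Bd] the bound of
    [stopped_transform_bound] is used, with [L + 2 * b = 4 * b + 1]. Of the constant [3 * c], one
    [c] comes from the overshoot and [2 * c] from [2 * c * K * P(B1)] through Doob's inequality. *)
Lemma stopped_estimate (A Bd : set T) (e K : R) : 0 <= e -> e <= 1 -> 0 <= K ->
  G 0 A -> measurable Bd ->
  (forall w, ~ Bd w -> forall k, (k <= n)%N -> `|dev k w| <= e) ->
  `|expect P (fun w => \1_A w * (U n w - U 0 w))| <=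
  e + (4 * b + 1) * fine (P (exceeds W K n))
    + (4 * b + 1 + 2 * c * K) * fine (P Bd)
    + 3 * c * expect P (fun w => \1_(exceeds W K n) w * W n w).
Proof.
move=> e0 e1 K0 GA mBd Bdev; set B1 := exceeds W K n.
have mA := @Gm _ _ GA.
have Wi i : intble P (W i) by apply: intbleD; exact: intble_norm.
have Wa i : adapted_to (G i) (W i).
  by apply: measurable_funD; apply: measurableT_comp => //; [exact: Xa|exact: Ya].
have W0 i w : 0 <= W i w by rewrite addr_ge0.
have Ws : closed_submart P G W n.
  apply: (@closed_submartD _ _ _ _ _ _ (fun i w => `|X i w|) (fun i w => `|Y i w|)) => //.
  - by move=> i; exact: intble_norm.
  - by move=> i; exact: intble_norm.
  - exact: closed_submart_norm.
  - exact: closed_submart_norm.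
have mB1 : measurable B1 by exact: (measurable_exceeds sG).
have [w0 _] : [set: T] !=set0.
  apply/set0P/negP => /eqP T0; have := probability_setT P.
  by rewrite T0 measure0 => /esym/eqP; rewrite onee_eq0.
have c0 : 0 <= c by rewrite (le_trans _ (pc 0 w0)).
have b0 : 0 <= b by rewrite (le_trans _ (Ub 0 w0)).
(* Where the deviation is at most [e <= 1], the transform is bounded by [2 * b + 1], so this level
   is never exceeded off [Bd]. *)
pose L := 2 * b + 1.
have L0 : 0 <= L by rewrite /L; lra.
have fEm i : measurable (first_exceeds W K i).
  by apply: (@Gm i); exact: G_first_exceeds.
pose S w := \sum_(i < n.+1) \1_(first_exceeds W K i) w * W i w.
have Si : intble P S by apply: intble_sum => i; exact: intble_indicM.
have st w := stopped_transform_bound w K0 L0.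
have Dsi : intble P (stopped_transform K L).
  apply: intble_sum => k; apply: intble_indicM; last exact: intble_step.
  by apply: (@Gm k); exact: G_alive.
have mUi i : intble P (U i) by exact: (@intble_bounded _ _ _ _ _ b).
have EDs : expect P (fun w => \1_A w * stopped_transform K L w) = 0.
  rewrite (eq_expect _ (g := fun w => \sum_(k < n) \1_(A `&` alive K L k) w * step k w)).
    rewrite expect_sum; last first.
      move=> k; apply: intble_indicM; last exact: intble_step.
      by apply: measurableI => //; apply: (@Gm k); exact: G_alive.
    rewrite big1// => k _; apply: expect_indic_step => //; apply: G_setI => //.
      exact: (@Gmono 0).
    exact: G_alive.
  move=> w; rewrite mulr_sumr; apply: eq_bigr => k _.
  by rewrite indicI mulrA.
have UDi : intble P (fun w => U n w - U 0 w - stopped_transform K L w).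
  by do 2 apply: intbleB => //.
rewrite (_ : expect P _ = expect P (fun w => \1_A w *
    (U n w - U 0 w - stopped_transform K L w))); last first.
  rewrite [RHS](eq_expect _ (g := fun w => \1_A w * (U n w - U 0 w) -
      \1_A w * stopped_transform K L w)); last by move=> w; ring.
  rewrite expectB ?EDs ?subr0//; apply: intble_indicM => //.
  exact: intbleB.
apply: (le_trans (le_normr_expect (intble_indicM mA UDi))).
pose rhs w := e + (4 * b + 1 + 2 * c * K) * (\1_B1 w + \1_Bd w) + c * S w.
have rhsi : intble P rhs.
  apply: intbleD; last exact: intbleZ.
  apply: intbleD; first exact: intble_cst.
  by apply: intbleZ; apply: intbleD; exact: intble_indic.
have S0 w : 0 <= S w by apply: sumr_ge0 => i _; rewrite mulr_ge0.
have cK0 := mulr_ge0 c0 K0.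
apply: (@le_trans _ _ (expect P rhs)).
  apply: le_expect => //; first by apply/intble_norm/intble_indicM.
  move=> w; rewrite normrM.
  apply: (@le_trans _ _ `|U n w - U 0 w - stopped_transform K L w|).
    by rewrite -[leRHS]mul1r ler_wpM2r// normr_indic.
  have cS := mulr_ge0 c0 (S0 w).
  have [sb sE] := st w.
  have [[B1w|Bdw]|/not_orP[nB1 nBd]] := pselect (B1 w \/ Bd w).
  - apply: (le_trans (ler_normB _ _)).
    have h1 := Ub n w; have h2 := Ub 0 w.
    have h3 := ler_normB (U n w) (U 0 w).
    rewrite /rhs indicE mem_set// mulrDr mulr1.
    have : 0 <= (4 * b + 1 + 2 * c * K) * (\1_Bd w : R).
      by rewrite mulr_ge0//; lra.
    rewrite -/(S w) in sb; rewrite /L in sb; lra.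
  - apply: (le_trans (ler_normB _ _)).
    have h1 := Ub n w; have h2 := Ub 0 w.
    have h3 := ler_normB (U n w) (U 0 w).
    rewrite /rhs [\1_Bd w]indicE mem_set// mulrDr mulr1.
    have : 0 <= (4 * b + 1 + 2 * c * K) * (\1_B1 w : R).
      by rewrite mulr_ge0//; lra.
    rewrite -/(S w) in sb; rewrite /L in sb; lra.
  - have dv := Bdev w nBd.
    rewrite sE; last first.
      move=> j jn; split.
        by rewrite leNgt; apply/negP => WK; apply: nB1; exists j.
      have h1 := Ub j w; have h2 := Ub 0 w; have h3 := ler_normB (U j w) (U 0 w).
      have := dv j jn; rewrite /dev distrC => h4.
      have := ler_normD (D j w - (U j w - U 0 w)) (U j w - U 0 w).
      rewrite subrK /L; lra.
    apply: (le_trans (dv n (leqnn n))).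
    rewrite /rhs !indicE memNset// [w \in Bd]memNset// addr0 mulr0 addr0; lra.
rewrite /rhs expectD; last 2 first.
- apply: intbleD; first exact: intble_cst.
  by apply: intbleZ; apply: intbleD; exact: intble_indic.
- exact: intbleZ.
rewrite expectD; last 2 first.
- exact: intble_cst.
- by apply: intbleZ; apply: intbleD; exact: intble_indic.
rewrite expect_cst expectZ; last by apply: intbleD; exact: intble_indic.
rewrite expectD; [|exact: intble_indic|exact: intble_indic].
rewrite !expect_indic// expectZ//.
have h1 : expect P S <= expect P (fun w => \1_B1 w * W n w).
  rewrite /S expect_sum; last by move=> i; exact: intble_indicM.
  apply: (submart_stopped_le Gm) => //.
    by move=> i _; exact: G_first_exceeds.
  move=> w; rewrite (@sum_indic_trivI _ _ _ _ _ B1)//.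
    by move=> i j; exact: first_exceeds_inj.
  exact: first_exceedsP.
have h2 : K * fine (P B1) <= expect P (fun w => \1_B1 w * W n w).
  exact: (doob_maximal sG Gm Gmono).
have := ler_wpM2l c0 h1; have := ler_wpM2l c0 h2; lra.
Qed.

End stopped_transform.

(** * Quadratic covariation along dyadic subdivisions *)

(** There are [m] blocks of length [p], and on block [i] the term [r] is nearly
    [al i * del + be i * gam] with coefficients constant on the block. A block sum of [del] or [gam]
    is a difference of two prefix sums, hence at most [2 * rho]; the two together cost [4 * c * rho]
    per block. An incomplete last block shows no such cancellation and is bounded crudely by
    [c2 * tau]. *)
Lemma block_sum_bound (R : realFieldType) (r del gam sig : nat -> R)
    (al be : nat -> R) (p m : nat) (c c1 c2 rho S tau : R) :
  (0 < p)%N -> 0 <= c -> 0 <= c1 -> 0 <= c2 -> (forall j, 0 <= sig j) ->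
  (forall i j, (i < m)%N -> (i * p <= j < i.+1 * p)%N ->
    `|r j - (al i * del j + be i * gam j)| <= c1 * sig j /\
    `|r j| <= c2 * sig j) ->
  (forall i, (i < m)%N -> `|al i| <= c /\ `|be i| <= c) ->
  (forall i, (i <= m)%N -> `|\sum_(0 <= j < i * p) del j| <= rho /\
     `|\sum_(0 <= j < i * p) gam j| <= rho) ->
  \sum_(0 <= j < m * p) sig j <= S ->
  (forall i, (i < m)%N -> \sum_(i * p <= j < i.+1 * p) sig j <= tau) ->
  0 <= tau ->
  forall k, (k <= m * p)%N ->
    `|\sum_(0 <= j < k) r j| <= c1 * S + 4 * c * rho * m%:R + c2 * tau.
Proof.
move=> p0 c0 c10 c20 sig0 rb ab dg sS st tau0.
have rho0 : 0 <= rho by have [h _] := dg 0%N isT; exact: le_trans h.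
have blk i : (i <= m)%N -> `|\sum_(0 <= j < i * p) r j| <=
    c1 * \sum_(0 <= j < i * p) sig j + 4 * c * rho * i%:R.
  elim: i => [|i IH] im.
    by rewrite mul0n !big_geq// normr0 !mulr0 addr0.
  have ip : (i * p <= i.+1 * p)%N by rewrite leq_mul2r leqnSn orbT.
  have [ha hb] := ab i im.
  have [d1 g1] := dg i (ltnW im); have [d2 g2] := dg i.+1 im.
  move: d2 g2; rewrite !(big_cat_nat (leq0n _) ip)//= => d2 g2.
  set Bd := \sum_(i * p <= j < i.+1 * p) del j in d2 *.
  set Bg := \sum_(i * p <= j < i.+1 * p) gam j in g2 *.
  have Bd2 : `|Bd| <= 2 * rho.
    have := ler_normB (\sum_(0 <= j < i * p) del j + Bd) (\sum_(0 <= j < i * p) del j).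
    rewrite [X in `|X| <= _](_ : _ = Bd); last by ring.
    lra.
  have Bg2 : `|Bg| <= 2 * rho.
    have := ler_normB (\sum_(0 <= j < i * p) gam j + Bg) (\sum_(0 <= j < i * p) gam j).
    rewrite [X in `|X| <= _](_ : _ = Bg); last by ring.
    lra.
  have Br : `|\sum_(i * p <= j < i.+1 * p) r j| <=
      c1 * \sum_(i * p <= j < i.+1 * p) sig j + 4 * c * rho.
    have -> : \sum_(i * p <= j < i.+1 * p) r j =
        \sum_(i * p <= j < i.+1 * p) (r j - (al i * del j + be i * gam j)) +
        (al i * Bd + be i * Bg).
      by rewrite /Bd /Bg !mulr_sumr -!big_split/=; apply: eq_bigr => j _; ring.
    apply: (le_trans (ler_normD _ _)); apply: lerD.
      apply: (le_trans (ler_norm_sum _ _ _)); rewrite mulr_sumr.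
      rewrite !big_nat; apply: ler_sum => j jb.
      by have [] := rb i j im jb.
    apply: (le_trans (ler_normD _ _)); rewrite !normrM.
    have h1 : `|al i| * `|Bd| <= c * (2 * rho) by apply: ler_pM.
    have h2 : `|be i| * `|Bg| <= c * (2 * rho) by apply: ler_pM.
    lra.
  apply: (le_trans (ler_normD _ _)); rewrite -natr1.
  have := IH (ltnW im); lra.
move=> k km; set i := (k %/ p)%N.
have ik : (i * p <= k)%N by exact: leq_trunc_div.
have ki : (k < i.+1 * p)%N by exact: ltn_ceil.
have im : (i <= m)%N by rewrite -(leq_pmul2r p0) (leq_trans ik).
have mono a b : (a <= b)%N -> \sum_(0 <= j < a) sig j <= \sum_(0 <= j < b) sig j.
  by move=> lab; rewrite (big_cat_nat (leq0n _) lab)//= lerDl sumr_ge0.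
rewrite (big_cat_nat (leq0n _) ik)//=; apply: (le_trans (ler_normD _ _)).
apply: lerD.
  apply: (le_trans (blk i im)); apply: lerD.
    by rewrite ler_wpM2l// (le_trans (mono _ _ _) sS)// leq_mul2r im orbT.
  by rewrite ler_wpM2l ?ler_nat// !mulr_ge0.
(* If [i = m] then [k = m * p] and the incomplete block is empty. *)
move: im; rewrite leq_eqVlt => /orP[/eqP ie|im].
  rewrite big_geq ?normr0 ?mulr_ge0//; by rewrite ie.
apply: (le_trans (ler_norm_sum _ _ _)).
apply: (@le_trans _ _ (c2 * \sum_(i * p <= j < k) sig j)).
  rewrite mulr_sumr !big_nat; apply: ler_sum => j /andP[j1 j2].
  by have [] := rb i j im _; rewrite ?j1 ?(ltn_trans j2)//.
rewrite ler_wpM2l// (le_trans _ (st i im))//.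
by rewrite [leRHS](big_cat_nat ik (ltnW ki))//= lerDl sumr_ge0.
Qed.

(** * Properties that hold off an event of small probability *)

Section with_high_probability.
Context d (T : measurableType d) (R : realType) (P : probability T R).
Implicit Types (Q : T -> Prop) (e : R).

(* [Q] itself need not be measurable. *)
Definition whp e Q :=
  exists E : set T, [/\ measurable E, (P E <= e%:E)%E & forall w, ~ E w -> Q w].

Lemma whpW e e' Q Q' : e <= e' -> (forall w, Q w -> Q' w) -> whp e Q -> whp e' Q'.
Proof.
move=> ee' QQ' [E [mE PE EQ]]; exists E; split => //.
  by rewrite (le_trans PE)// lee_fin.
by move=> w /EQ/QQ'.
Qed.

Lemma whp_and e e' Q Q' : whp e Q -> whp e' Q' -> whp (e + e') (fun w => Q w /\ Q' w).
Proof.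
move=> [E [mE PE EQ]] [E' [mE' PE' EQ']]; exists (E `|` E'); split.
- exact: measurableU.
- rewrite EFinD (le_trans (measureU2 _ _ _))// leeD//.
- by move=> w /not_orP[nE nE']; split; [exact: EQ|exact: EQ'].
Qed.

Lemma whp_ae e Q : 0 <= e -> (\forall w \ae P, Q w) -> whp e Q.
Proof.
move=> e0 [E [mE PE EQ]]; exists E; split => //.
  by rewrite PE lee_fin.
by move=> w nE; apply: contrapT => nQ; apply: nE; exact: EQ.
Qed.

Lemma whp_set e (A : set T) : measurable A -> (P (~` A) <= e%:E)%E -> whp e A.
Proof.
move=> mA PA; exists (~` A); split => //; first exact: measurableC.
by move=> w nAw; apply: contrapT.
Qed.

Lemma whp_forall e (Q : nat -> T -> Prop) n :
  (forall i, (i < n)%N -> whp e (Q i)) ->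
  whp (n%:R * e) (fun w => forall i, (i < n)%N -> Q i w).
Proof.
elim: n => [|n IH] Qi.
  by exists set0; split => //; rewrite mul0r measure0.
have h1 := IH (fun i ni => Qi i (ltnW ni)).
apply: whpW (whp_and h1 (Qi n (ltnSn n))).
  by rewrite -natr1 mulrDl mul1r.
move=> w [hw hn] i; rewrite ltnS leq_eqVlt => /orP[/eqP ->//|]; exact: hw.
Qed.

(** Continuity from below: a threshold that is almost surely finite but random becomes deterministic
    at the cost of an event of probability at most [e]. *)
Lemma whp_eventually e (A : nat -> set T) : 0 < e ->
  (forall n, measurable (A n)) -> (forall n, A n `<=` A n.+1) ->
  (\forall w \ae P, exists n, A n w) -> exists n, whp e (A n).
Proof.
move=> e0 mA ndA exA.
have ndA' : {homo A : n m / (n <= m)%N >-> n `<=` m}.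
  by apply: homo_leq => [X w|X Y Z YX XZ w /YX/XZ|].
have mU : measurable (\bigcup_n A n) by exact: bigcup_measurable.
have PU : P (\bigcup_n A n) = 1%E.
  have -> : P (\bigcup_n A n) = P setT.
    apply/eqP; rewrite eq_le; apply/andP; split.
      by apply: le_measure; rewrite ?inE.
    have [N [mN PN NA]] := exA.
    rewrite -[leRHS]adde0 -PN (le_trans _ (measureU2 _ _ _))//.
    apply: le_measure; rewrite ?inE//; first exact: measurableU.
    move=> w _; have [Aw|nAw] := pselect (exists n, A n w).
      by left; case: Aw => n Anw; exists n.
    by right; apply: NA.
  exact: probability_setT.
have cv : P (A n) @[n --> \oo] --> P (\bigcup_n A n).
  apply: nondecreasing_cvg_mu => //.
  by move=> n m nm; apply/subsetPset; exact: ndA'.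
rewrite PU in cv.
have : \forall n \near \oo, ((1 - e)%:E < P (A n))%E.
  by apply: (cv [set y | ((1 - e)%:E < y)%E]); apply: open_ereal_gt'; rewrite lte_fin; lra.
move=> [n _ /(_ n (leqnn n)) h]; exists n; apply: whp_set => //.
have fP := fineP_fin P (mA n); rewrite probability_setC// -fP -EFinB lee_fin.
by move: h; rewrite -fP lte_fin; lra.
Qed.

End with_high_probability.
Arguments whp {d T R} P e Q.

Definition dyadic (R : realType) (l j : nat) : R := j%:R / 2 ^+ l.

(** * Dyadic times and uniform continuity on compact intervals *)

Section dyadic.
Context (R : realType).
Local Notation dyadic := (dyadic R).

Lemma dyadic_ge0 l j : 0 <= dyadic l j.
Proof. by rewrite divr_ge0// exprn_ge0. Qed.

Lemma le_dyadic l i j : (dyadic l i <= dyadic l j) = (i <= j)%N.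
Proof. by rewrite ler_pM2r ?invr_gt0 ?exprn_gt0// ler_nat. Qed.

Lemma lt_dyadic l i j : (dyadic l i < dyadic l j) = (i < j)%N.
Proof. by rewrite ltr_pM2r ?invr_gt0 ?exprn_gt0// ltr_nat. Qed.

Lemma dyadicS l j : dyadic l j.+1 - dyadic l j = 2 ^- l.
Proof. by rewrite -mulrBl -natr1 addrAC subrr add0r mul1r. Qed.

Lemma dyadic_refine m l a : (m <= l)%N ->
  dyadic m a = dyadic l (a * 2 ^ (l - m)).
Proof.
move=> ml; rewrite /dyadic natrM natrX -{2}(subnKC ml) exprD.
rewrite [X in _ = _ / X]mulrC invfM mulrA mulfK//.
Qed.

Lemma dyadic0 j : dyadic 0 j = j%:R.
Proof. by rewrite /dyadic expr0 divr1. Qed.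

Lemma exp2V_small (e : R) : 0 < e -> exists n : nat, 2 ^- n < e.
Proof.
move=> /ltr_add_invr[n]; rewrite add0r => ne; exists n.+1.
apply: le_lt_trans ne; rewrite lef_pV2 ?posrE ?exprn_gt0//.
by rewrite -natrX ler_nat ltnW// ltn_expl.
Qed.

Lemma le_exp2V n m : (n <= m)%N -> 2 ^- m <= 2 ^- n :> R.
Proof.
move=> nm; rewrite lef_pV2 ?posrE ?exprn_gt0//.
by rewrite -!natrX ler_nat leq_pexp2l.
Qed.

Lemma uniform_continuity (f : R -> R) (t e : R) :
  {within `[0, +oo[, continuous f} -> 0 < e ->
  exists n : nat, forall x y, 0 <= x <= t -> 0 <= y <= t ->
    `|x - y| <= 2 ^- n -> `|f x - f y| <= e.
Proof.
move=> /subspace_continuousP cf e0.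
have := @segment_compact R 0 t; rewrite compact_near_coveringP.
(* The bounds on [x] are part of the property because the neighbourhoods are taken in [R], while
   continuity is known only within the half-line. *)
move=> /(_ nat \oo (fun n x => x <= t -> 0 <= x -> forall y, 0 <= y <= t ->
    `|x - y| <= 2 ^- n -> `|f x - f y| <= e)).
have H x : (`[0, t]%classic : set R) x ->
    \forall x' \near x & n \near \oo, x' <= t -> 0 <= x' ->
    forall y, 0 <= y <= t -> `|x' - y| <= 2 ^- n -> `|f x' - f y| <= e.
  rewrite /= in_itv/= => /andP[x0 xt].
  have := cf x; rewrite /= in_itv/= andbT => /(_ x0) /cvgrPdist_lt /(_ (e / 2)).
  rewrite divr_gt0// => /(_ isT); rewrite near_withinE.
  move=> /nbhs_ballP[dl /= dl0 h].
  have [n ne] := exp2V_small (divr_gt0 dl0 (ltr0n R 2)).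
  exists (ball x (dl / 2), [set k | (n <= k)%N]) => /=.
    by split; [apply: nbhsx_ballx; rewrite divr_gt0|exists n].
  move=> [x' k] [/= xx' nk] x't x'0 y /andP[y0 yt] x'y.
  have kn := le_exp2V nk.
  have h1 : `|f x - f x'| < e / 2.
    apply: h; rewrite /= ?in_itv/= ?andbT//.
    by apply: (lt_trans xx'); lra.
  have h2 : `|f x - f y| < e / 2.
    apply: h; rewrite /= ?in_itv/= ?andbT//.
    have := ler_distD x' x y; rewrite /ball/= in xx' *; lra.
  have := ler_distD (f x) (f x') (f y); rewrite [`|f x' - f x|]distrC; lra.
move=> /(_ _ H) [n _ h]; exists n => x y /andP[x0 xt] yt xy.
apply: (h n (leqnn n) x _ xt x0 y yt xy).
by rewrite /= in_itv/= x0.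
Qed.

End dyadic.
Arguments dyadic {R} l j.

(** * Path oscillation and covariation sums at dyadic times *)

Section quadratic_sums.
Context d (T : measurableType d) (R : realType) (P : probability T R).
Implicit Types X Y Q : R -> {RV P >-> R}.
Local Notation dyadic := (@dyadic R).

(** Only dyadic times are compared, so the event is a countable intersection and is measurable
    although the paths are continuous only almost surely. *)
Definition dyadic_osc X (t e : R) m (w : T) := forall l i j,
  dyadic l i <= t -> dyadic l j <= t -> `|dyadic l i - dyadic l j| <= 2 ^- m ->
  `|X (dyadic l i) w - X (dyadic l j) w| <= e.

Lemma measurable_dyadic_osc X t e m : measurable [set w | dyadic_osc X t e m w].
Proof.
rewrite (_ : [set w | _] = \bigcap_l \bigcap_i \bigcap_(j in [set j |
   dyadic l i <= t /\ dyadic l j <= t /\ `|dyadic l i - dyadic l j| <= 2 ^- m])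
   ((fun w => `|X (dyadic l i) w - X (dyadic l j) w|) @^-1` `]-oo, e])); last first.
  apply/seteqP; split => w /= h.
    by move=> l _ i _ j /= [h1 [h2 h3]]; rewrite in_itv/=; exact: h.
  move=> l i j h1 h2 h3; have := h l I i I j (conj h1 (conj h2 h3)).
  by rewrite /= in_itv.
do 3 apply: bigcap_measurableType => ? _.
rewrite -[X in measurable X]setTI; apply: (_ : measurable_fun setT _) => //.
by apply: measurableT_comp => //; exact: measurable_funB.
Qed.

Lemma whp_dyadic_osc X t e eta : as_continuous X -> 0 < e -> 0 < eta ->
  exists m0, forall m, (m0 <= m)%N -> whp P eta (dyadic_osc X t e m).
Proof.
move=> cX e0 eta0.
have mono m m' w : (m <= m')%N -> dyadic_osc X t e m w -> dyadic_osc X t e m' w.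
  by move=> mm' h l i j ? ? ?; apply: h => //; exact: le_trans (le_exp2V _ mm').
have [m0 Hm0] : exists m, whp P eta [set w | dyadic_osc X t e m w].
  apply: whp_eventually => //; first by move=> m; exact: measurable_dyadic_osc.
    by move=> m w; exact: mono.
  apply: filterS cX => w cw; have [m h] := uniform_continuity t cw e0.
  by exists m => l i j hi hj hij; apply: h; rewrite ?dyadic_ge0.
by exists m0 => m mm; apply: whpW Hm0 => // w; exact: mono.
Qed.

Lemma whp_bounded (Z : {RV P >-> R}) eta : 0 < eta ->
  exists2 K : R, 0 <= K & whp P eta (fun w => `|Z w| <= K).
Proof.
move=> eta0.
have [m0 Hm0] : exists m : nat, whp P eta [set w | `|Z w| <= m%:R].
  apply: whp_eventually => //.
  - move=> m; rewrite (_ : [set w | _] = (fun w => `|Z w|) @^-1` `]-oo, m%:R]).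
      rewrite -[X in measurable X]setTI; apply: (_ : measurable_fun setT _) => //.
      exact: measurableT_comp.
    by apply/seteqP; split => w /=; rewrite in_itv.
  - by move=> m w /= h; apply: (le_trans h); rewrite ler_nat.
  - apply: aeW => w; exists (Num.bound `|Z w|) => /=.
    by apply/ltW/archi_boundP.
by exists m0%:R.
Qed.

Definition qsum X Y l k w : R := \sum_(0 <= j < k)
  (X (dyadic l j.+1) w - X (dyadic l j) w) *
  (Y (dyadic l j.+1) w - Y (dyadic l j) w).

Definition dyadic_partition l k : seq R := [seq dyadic l j | j <- iota 1 k].

Lemma nth_dyadic_partition l k j : (j <= k)%N ->
  nth 0 (0 :: dyadic_partition l k) j = dyadic l j.
Proof.
case: j => [|j] jk /=; first by rewrite /dyadic mul0r.
by rewrite (nth_map 0%N) ?size_iota// nth_iota.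
Qed.

Lemma size_dyadic_partition l k : size (dyadic_partition l k) = k.
Proof. by rewrite size_map size_iota. Qed.

Lemma itv_dyadic_partition l k :
  itv_partition 0 (dyadic l k) (dyadic_partition l k).
Proof.
split; last first.
  by rewrite (last_nth 0) size_dyadic_partition nth_dyadic_partition.
apply/(pathP 0) => i; rewrite size_dyadic_partition => ik.
rewrite nth_dyadic_partition 1?ltnW//.
by rewrite -[nth 0 _ i]/(nth 0 (0 :: _) i.+1) nth_dyadic_partition// lt_dyadic.
Qed.

Lemma mesh_dyadic_partition l k : mesh (dyadic_partition l k) <= 2 ^- l.
Proof.
rewrite /mesh size_dyadic_partition big_nat_cond.
elim/big_ind: _ => //.
  by move=> x y hx hy; rewrite ge_max hx.
move=> i /andP[/andP[_ ik] _].
by rewrite !nth_dyadic_partition ?dyadicS// ltnW.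
Qed.

Lemma covariation_sum_dyadic X Y l k w :
  covariation_sum X Y (dyadic_partition l k) w = qsum X Y l k w.
Proof.
rewrite /covariation_sum /qsum size_dyadic_partition !big_nat.
by apply: eq_bigr => i /andP[_ ik]; rewrite !nth_dyadic_partition// ltnW.
Qed.

Lemma measurable_qsum X Y l k : measurable_fun setT (qsum X Y l k).
Proof.
apply: measurable_sum => j; apply: measurable_funM; exact: measurable_funB.
Qed.

Lemma whp_qsum X Y Q m a e eta : is_quadratic_covariation X Y Q ->
  0 < e -> 0 < eta -> exists l0, forall l, (l0 <= l)%N -> (m <= l)%N ->
    whp P eta (fun w =>
      `|qsum X Y l (a * 2 ^ (l - m)) w - Q (dyadic m a) w| <= e).
Proof.
move=> [_ /(_ (dyadic m a) (dyadic_ge0 _ _ _) e eta)] h e0 eta0.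
have [dl dl0 {}h] := h e0 eta0.
have [l0 l0d] := exp2V_small dl0.
exists l0 => l l0l ml.
set k := (a * 2 ^ (l - m))%N.
have := h (dyadic_partition l k).
rewrite (dyadic_refine R a ml) => /(_ (itv_dyadic_partition _ _)) {}h.
have {}h := h (le_lt_trans (mesh_dyadic_partition _ _)
  (le_lt_trans (le_exp2V R l0l) l0d)).
eexists; split; last 2 first.
- exact: ltW h.
- move=> w /=; rewrite covariation_sum_dyadic => /negP; rewrite -ltNge => /ltW.
  by [].
under eq_set do rewrite covariation_sum_dyadic.
rewrite (_ : [set w | _] =
    (fun w => `|qsum X Y l k w - Q (dyadic l k) w|) @^-1` `[e, +oo[).
  rewrite -[X in measurable X]setTI; apply: (_ : measurable_fun setT _) => //.
  apply: measurableT_comp => //; apply: measurable_funB => //.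
  exact: measurable_qsum.
by apply/seteqP; split => w /=; rewrite in_itv/= andbT.
Qed.

Lemma whp_qsum_le X Y Q m A e eta : is_quadratic_covariation X Y Q ->
  0 < e -> 0 < eta -> exists l0, forall l, (l0 <= l)%N -> (m <= l)%N ->
    whp P eta (fun w => forall a, (a < A)%N ->
      `|qsum X Y l (a * 2 ^ (l - m)) w - Q (dyadic m a) w| <= e).
Proof.
(* Union bound over [A] times; the added 1 keeps the denominator positive when [A = 0]. *)
move=> qc e0 eta0; set eta' := eta / (A%:R + 1).
have A1 : 0 < A%:R + 1 :> R by rewrite ltr_wpDl.
have eta'0 : 0 < eta' by rewrite divr_gt0.
have [f hf] := choice (fun a => whp_qsum m a qc e0 eta'0).
exists (\max_(a < A) f a)%N => l fl ml.
have H a : (a < A)%N -> whp P eta' (fun w =>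
    `|qsum X Y l (a * 2 ^ (l - m)) w - Q (dyadic m a) w| <= e).
  move=> aA; apply: hf => //; apply: leq_trans fl.
  exact: (leq_bigmax (Ordinal aA)).
apply: whpW (whp_forall H) => //.
by rewrite /eta' mulrCA ger_pMr// ler_pdivrMr// mul1r lerDl.
Qed.

End quadratic_sums.

(* [px], [py] are the first partial derivatives of a harmonic function [phi] on
   the closed upper half-plane and [a = phi_xx / 2 = - phi_yy / 2], [b = phi_xy],
   so the quadratic Taylor term is [a (h^2 - k^2) + b h k]. *)
Record harmonic_jet (R : realType) (phi px py a b : R -> R -> R) (B c : R) :
    Prop := HarmonicJet {
  jet_bound : forall x y, `|phi x y| <= B;
  jet_px : forall x y, `|px x y| <= c;
  jet_py : forall x y, `|py x y| <= c;
  jet_a : forall x y, `|a x y| <= c;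
  jet_b : forall x y, `|b x y| <= c;
  jet_lip_a : forall x y x' y', 0 <= y -> 0 <= y' ->
    `|a x y - a x' y'| <= c * (`|x - x'| + `|y - y'|);
  jet_lip_b : forall x y x' y', 0 <= y -> 0 <= y' ->
    `|b x y - b x' y'| <= c * (`|x - x'| + `|y - y'|);
  jet_taylor : forall x y x' y', 0 <= y -> 0 <= y' ->
    let h := x' - x in let k := y' - y in
    `|phi x' y' - phi x y - px x y * h - py x y * k
       - (a x y * (h ^+ 2 - k ^+ 2) + b x y * (k * h))|
    <= c * (`|h| + `|k|) * (h ^+ 2 + k ^+ 2);
  jet_meas : measurable_fun setT (fun z : R * R => phi z.1 z.2);
  jet_meas_px : measurable_fun setT (fun z : R * R => px z.1 z.2);
  jet_meas_py : measurable_fun setT (fun z : R * R => py z.1 z.2)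
}.

Section jet.
Context (R : realType) (phi px py a b : R -> R -> R) (B c : R).
Hypothesis jet : harmonic_jet phi px py a b B c.

Lemma jet_c_ge0 : 0 <= c.
Proof. by rewrite (le_trans _ (jet_px jet 0 0)). Qed.

Lemma jet_B_ge0 : 0 <= B.
Proof. by rewrite (le_trans _ (jet_bound jet 0 0)). Qed.

(** Only the first order terms are subtracted, since they form the martingale transform. The second
    order part stays in the remainder, where it must be shown to cancel in the sum. *)
Definition jet_rem (x y : nat -> R) j : R :=
  phi (x j.+1) (y j.+1) - phi (x j) (y j) - px (x j) (y j) * (x j.+1 - x j)
  - py (x j) (y j) * (y j.+1 - y j).

(** The second derivatives are frozen at the left end of each block. Each constant 3 counts the
    Taylor error and the contributions of [a] and of [b]: with frozen coefficients each is at most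
    [c * om] times the squared increments, without freezing at most [c] times them. *)
Lemma jet_rem_bound (x y : nat -> R) (p m : nat) (om rho S tau : R) :
  (0 < p)%N -> 0 <= om <= 1 -> 0 <= tau ->
  (forall j, (j <= m * p)%N -> 0 <= y j) ->
  (forall i j j', (i < m)%N -> (i * p <= j <= i.+1 * p)%N ->
    (i * p <= j' <= i.+1 * p)%N ->
    `|x j - x j'| <= om / 2 /\ `|y j - y j'| <= om / 2) ->
  (forall i, (i <= m)%N ->
    `|\sum_(0 <= j < i * p) ((x j.+1 - x j) ^+ 2 - (y j.+1 - y j) ^+ 2)| <= rho /\
    `|\sum_(0 <= j < i * p) ((y j.+1 - y j) * (x j.+1 - x j))| <= rho) ->
  \sum_(0 <= j < m * p) ((x j.+1 - x j) ^+ 2 + (y j.+1 - y j) ^+ 2) <= S ->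
  (forall i, (i < m)%N -> \sum_(i * p <= j < i.+1 * p)
    ((x j.+1 - x j) ^+ 2 + (y j.+1 - y j) ^+ 2) <= tau) ->
  forall k, (k <= m * p)%N -> `|\sum_(0 <= j < k) jet_rem x y j| <=
    3 * c * om * S + 4 * c * rho * m%:R + 3 * c * tau.
Proof.
move=> p0 /andP[om0 om1] tau0 y0 osc bs Ss taus.
have c0 := jet_c_ge0.
apply: (@block_sum_bound _ (jet_rem x y)
  (fun j => (x j.+1 - x j) ^+ 2 - (y j.+1 - y j) ^+ 2)
  (fun j => (y j.+1 - y j) * (x j.+1 - x j))
  (fun j => (x j.+1 - x j) ^+ 2 + (y j.+1 - y j) ^+ 2)
  (fun i => a (x (i * p)%N) (y (i * p)%N))
  (fun i => b (x (i * p)%N) (y (i * p)%N))) => //.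
- by rewrite !mulr_ge0.
- by rewrite mulr_ge0.
- by move=> j; rewrite addr_ge0// sqr_ge0.
- move=> i j im /andP[ij ji].
  have jm : (j < m * p)%N by rewrite (leq_trans ji)// leq_mul2r im orbT.
  have ip : (i * p <= i.+1 * p)%N by rewrite leq_mul2r leqnSn orbT.
  have := jet_taylor jet (x j) (x j.+1) (y0 _ (ltnW jm)) (y0 _ jm).
  have := jet_lip_a jet (x j) (x (i * p)%N) (y0 _ (ltnW jm))
    (y0 _ (leq_trans ij (ltnW jm))).
  have := jet_lip_b jet (x j) (x (i * p)%N) (y0 _ (ltnW jm))
    (y0 _ (leq_trans ij (ltnW jm))).
  have [u1 u2] : `|x j.+1 - x j| <= om / 2 /\ `|y j.+1 - y j| <= om / 2.
    by apply: (osc i); rewrite // ?ij ?(ltnW ji) ?ji ?(leqW ij).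
  have [u3 u4] : `|x j - x (i * p)%N| <= om / 2 /\ `|y j - y (i * p)%N| <= om / 2.
    by apply: (osc i); rewrite // ?ij ?(ltnW ji) ?leqnn ?ip.
  have := jet_a jet (x j) (y j); have := jet_b jet (x j) (y j).
  rewrite /jet_rem /=.
  set h := x j.+1 - x j in u1 *; set k := y j.+1 - y j in u2 *.
  set aj := a _ _; set bj := b _ _; set ai := a _ _; set bi := b _ _.
  set r := phi _ _ - _ - _ - _ => hb ha lb la tay.
  have sig0 : 0 <= h ^+ 2 + k ^+ 2 by rewrite addr_ge0// sqr_ge0.
  have d1 : `|h ^+ 2 - k ^+ 2| <= h ^+ 2 + k ^+ 2.
    by rewrite ler_norml; have := sqr_ge0 h; have := sqr_ge0 k; lra.
  have d2 : `|k * h| <= h ^+ 2 + k ^+ 2.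
    rewrite ler_norml; have := sqr_ge0 (h + k); have := sqr_ge0 (h - k).
    by rewrite !expr2; lra.
  have t1 : c * (`|h| + `|k|) * (h ^+ 2 + k ^+ 2) <= c * om * (h ^+ 2 + k ^+ 2).
    by rewrite ler_wpM2r// ler_wpM2l//; lra.
  have t2 : `|aj - ai| * `|h ^+ 2 - k ^+ 2| <= c * om * (h ^+ 2 + k ^+ 2).
    apply: ler_pM => //; apply: (le_trans la); rewrite ler_wpM2l//; lra.
  have t3 : `|bj - bi| * `|k * h| <= c * om * (h ^+ 2 + k ^+ 2).
    apply: ler_pM => //; apply: (le_trans lb); rewrite ler_wpM2l//; lra.
  have t4 : `|aj| * `|h ^+ 2 - k ^+ 2| <= c * (h ^+ 2 + k ^+ 2) by apply: ler_pM.
  have t5 : `|bj| * `|k * h| <= c * (h ^+ 2 + k ^+ 2) by apply: ler_pM.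
  split.
    have -> : r - (ai * (h ^+ 2 - k ^+ 2) + bi * (k * h)) =
      (r - (aj * (h ^+ 2 - k ^+ 2) + bj * (k * h))) +
      ((aj - ai) * (h ^+ 2 - k ^+ 2) + (bj - bi) * (k * h)) by ring.
    apply: (le_trans (ler_normD _ _)).
    have := ler_normD ((aj - ai) * (h ^+ 2 - k ^+ 2)) ((bj - bi) * (k * h)).
    rewrite (normrM (aj - ai)) (normrM (bj - bi)); lra.
  have -> : r = (r - (aj * (h ^+ 2 - k ^+ 2) + bj * (k * h))) +
      (aj * (h ^+ 2 - k ^+ 2) + bj * (k * h)) by ring.
  apply: (le_trans (ler_normD _ _)).
  have := ler_normD (aj * (h ^+ 2 - k ^+ 2)) (bj * (k * h)).
  have : c * om * (h ^+ 2 + k ^+ 2) <= c * 1 * (h ^+ 2 + k ^+ 2).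
    by rewrite ler_wpM2r// ler_wpM2l.
  rewrite (normrM aj) (normrM bj); lra.
- by move=> i im; split; [exact: jet_a jet _ _|exact: jet_b jet _ _].
Qed.

End jet.

(** * Smallness in probability of the summed Taylor remainders *)

Section remainder.
Context d (T : measurableType d) (R : realType) (P : probability T R).
Local Notation dyadic := (@dyadic R).
Variables (M N QM QN QMN : R -> {RV P >-> R}).
Hypothesis M_cont : as_continuous M.
Hypothesis N_cont : as_continuous N.
Hypothesis QM_def : is_quadratic_variation M QM.
Hypothesis QN_def : is_quadratic_variation N QN.
Hypothesis QMN_def : is_quadratic_covariation M N QMN.
Hypothesis QM_eq_QN : \forall w \ae P, forall t, 0 <= t -> QM t w = QN t w.
Hypothesis QMN_eq0 : \forall w \ae P, forall t, 0 <= t -> QMN t w = 0.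
Hypothesis M_ge0 : \forall w \ae P, forall t, 0 <= t -> 0 <= M t w.
Variables (phi px py a b : R -> R -> R) (B c : R).
Hypothesis jet : harmonic_jet phi px py a b B c.

(** The choices are made in the order [Rq] (bound on the quadratic variation), [om], the block level
    [m], [rho] and finally the level [l]. Equality of the quadratic variations makes the prefix sums
    of dN^2 - dM^2 at most [rho], and vanishing covariation does the same for those of dN dM. *)
Lemma whp_remainder m0 A (e eta : R) : 0 < e -> 0 < eta ->
  exists2 l, (m0 <= l)%N & whp P eta (fun w =>
    forall k, (k <= A * 2 ^ (l - m0))%N ->
    `|\sum_(0 <= j < k) jet_rem phi px py
       (fun j => N (dyadic l j) w) (fun j => M (dyadic l j) w) j| <= e).
Proof.
move=> e0 eta0; have c0 := jet_c_ge0 jet.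
(* Eight events are combined below, each with exceptional probability at most [et]. *)
pose et := eta / 8; have et0 : 0 < et by rewrite divr_gt0.
pose t := dyadic m0 A.
have [Rq Rq0 HR] := whp_bounded (QM t) et0.
pose S := 2 * Rq + 2.
pose om := Num.min 1 (e / (2 * (3 * c * S + 6 * c + 1))).
have cS0 : 0 <= c * S by rewrite mulr_ge0// /S; lra.
have den0 : 0 < 2 * (3 * c * S + 6 * c + 1) by lra.
have om0 : 0 < om by rewrite lt_min ltr01 divr_gt0.
have om1 : om <= 1 by rewrite ge_min lexx.
have omE : 3 * c * om * S + 6 * c * om <= e / 2.
  have : om <= e / (2 * (3 * c * S + 6 * c + 1)) by rewrite ge_min lexx orbT.
  by rewrite ler_pdivlMr//; lra.
have om20 : 0 < om / 2 by lra.
have [m1 HN] := whp_dyadic_osc t N_cont om20 et0.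
have [m2 HM] := whp_dyadic_osc t M_cont om20 et0.
have [m3 HQ] := whp_dyadic_osc t QM_def.1 om0 et0.
pose m := maxn m0 (maxn m1 (maxn m2 m3)).
have m0m : (m0 <= m)%N by rewrite leq_max leqnn.
have {}HN := HN m ltac:(by rewrite !leq_max leqnn ?orbT).
have {}HM := HM m ltac:(by rewrite !leq_max leqnn ?orbT).
have {}HQ := HQ m ltac:(by rewrite !leq_max leqnn ?orbT).
pose mb := (A * 2 ^ (m - m0))%N.
(* The tolerance depends on the number [mb] of blocks, which is why the level [l] can only be fixed
   after [m]. *)
pose rho := Num.min 1 (e / (2 * (4 * c * mb%:R + 12 * c + 1))).
have cmb0 : 0 <= c * mb%:R :> R by rewrite mulr_ge0.
have den1 : 0 < 2 * (4 * c * mb%:R + 12 * c + 1) by lra.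
have rho0 : 0 < rho by rewrite lt_min ltr01 divr_gt0.
have rho1 : rho <= 1 by rewrite ge_min lexx.
have rhoE : 4 * c * rho * mb%:R + 12 * c * rho <= e / 2.
  have : rho <= e / (2 * (4 * c * mb%:R + 12 * c + 1)) by rewrite ge_min lexx orbT.
  by rewrite ler_pdivlMr//; lra.
have rho20 : 0 < rho / 2 by lra.
have [l1 HqN] := whp_qsum_le m mb.+1 QN_def rho20 et0.
have [l2 HqM] := whp_qsum_le m mb.+1 QM_def rho20 et0.
have [l3 HqMN] := whp_qsum_le m mb.+1 QMN_def rho20 et0.
pose l := maxn m (maxn l1 (maxn l2 l3)).
have ml : (m <= l)%N by rewrite leq_max leqnn.
have {}HqN := HqN l ltac:(by rewrite !leq_max leqnn ?orbT) ml.
have {}HqM := HqM l ltac:(by rewrite !leq_max leqnn ?orbT) ml.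
have {}HqMN := HqMN l ltac:(by rewrite !leq_max leqnn ?orbT) ml.
have Hae : whp P et (fun w => [/\ (forall t, 0 <= t -> QM t w = QN t w),
    (forall t, 0 <= t -> QMN t w = 0) & (forall t, 0 <= t -> 0 <= M t w)]).
  apply: whp_ae; first exact: ltW.
  by apply: filterS3 QM_eq_QN QMN_eq0 M_ge0.
exists l; first exact: leq_trans ml.
have := whp_and (whp_and (whp_and HR HN) (whp_and HM HQ))
  (whp_and (whp_and HqN HqM) (whp_and HqMN Hae)).
apply: whpW; first by rewrite /et; lra.
move=> w [[[hR hN] [hM hQ]] [[hqN hqM] [hqMN [hQQ hMN hM0]]]].
pose p := (2 ^ (l - m))%N; have p0 : (0 < p)%N by rewrite expn_gt0.
have Amb : (A * 2 ^ (l - m0) = mb * p)%N.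
  by rewrite /mb /p -mulnA -expnD addnC addnBA// subnK.
have tE : t = dyadic l (mb * p) by rewrite -Amb -dyadic_refine// (leq_trans m0m).
have blkE i : dyadic l (i * p) = dyadic m i by rewrite [RHS](dyadic_refine _ _ ml).
have tEm : t = dyadic m mb by rewrite tE blkE.
pose x j := N (dyadic l j) w; pose y j := M (dyadic l j) w.
have xx i : \sum_(0 <= j < i * p) (x j.+1 - x j) ^+ 2 = qsum N N l (i * p) w by [].
have yy i : \sum_(0 <= j < i * p) (y j.+1 - y j) ^+ 2 = qsum M M l (i * p) w by [].
have xyE i : \sum_(0 <= j < i * p) ((x j.+1 - x j) ^+ 2 + (y j.+1 - y j) ^+ 2) =
    qsum N N l (i * p) w + qsum M M l (i * p) w.
  by rewrite big_split/= xx yy.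
rewrite Amb => k kmb.
(* Over one block the limit variation grows by at most [om], once for [N] and once for [M], and the
   errors of the sums at the block ends fit into [4 * rho]. The terms in [om] and those in [rho]
   then take half of [e] each. *)
have := @jet_rem_bound _ _ _ _ _ _ _ _ jet x y p mb om rho S (2 * om + 4 * rho).
rewrite p0 ltW// om1 => /(_ isT isT) h.
apply: (le_trans (h _ _ _ _ _ _ k kmb)).
- lra.
- by move=> j _; apply: hM0; exact: dyadic_ge0.
- move=> i j j' im /andP[ij ji] /andP[ij' ji'].
  have jb j0 : (j0 <= i.+1 * p)%N -> dyadic l j0 <= t.
    by move=> h0; rewrite tE le_dyadic (leq_trans h0)// leq_mul2r im orbT.
  have jj : `|dyadic l j - dyadic l j'| <= 2 ^- m.
    have hb j0 : (i * p <= j0 <= i.+1 * p)%N ->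
        dyadic m i <= dyadic l j0 <= dyadic m i.+1.
      by move=> /andP[h1 h2]; rewrite -!blkE !le_dyadic h1.
    have /andP[h1 h2] : dyadic m i <= dyadic l j <= dyadic m i.+1.
      by apply: hb; rewrite ij.
    have /andP[h3 h4] : dyadic m i <= dyadic l j' <= dyadic m i.+1.
      by apply: hb; rewrite ij'.
    have := dyadicS R m i; rewrite ler_norml; lra.
  by split; [apply: hN|apply: hM] => //; exact: jb.
- move=> i imb; have i1 : (i < mb.+1)%N by [].
  have h1 := hqN i i1; have h2 := hqM i i1; have h3 := hqMN i i1.
  rewrite -/p -hQQ ?dyadic_ge0// in h1; rewrite -/p in h2.
  rewrite -/p hMN ?dyadic_ge0// subr0 in h3; split.
    rewrite sumrB xx yy; move: h1 h2; rewrite !ler_norml; lra.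
  by apply: (le_trans h3); lra.
- rewrite xyE; have h1 := hqN mb (ltnSn mb); have h2 := hqM mb (ltnSn mb).
  rewrite -/p -hQQ ?dyadic_ge0// -tEm in h1; rewrite -/p -tEm in h2.
  move: h1 h2 hR; rewrite !ler_norml /S; lra.
- move=> i im.
  have e1 := xyE i.+1.
  rewrite (big_cat_nat (n := i * p))//= in e1; last by rewrite leq_mul2r leqnSn orbT.
  rewrite xyE in e1.
  have i1 : (i < mb.+1)%N by exact: ltnW.
  have h1 := hqN i i1; have h2 := hqM i i1.
  have h3 := hqN i.+1 im; have h4 := hqM i.+1 im.
  rewrite -/p -hQQ ?dyadic_ge0// in h1; rewrite -/p in h2.
  rewrite -/p -hQQ ?dyadic_ge0// in h3; rewrite -/p in h4.
  have h5 : `|QM (dyadic m i.+1) w - QM (dyadic m i) w| <= om.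
    rewrite -!blkE; apply: hQ; rewrite ?tE ?le_dyadic ?leq_mul2r ?im ?(ltnW im) ?orbT//.
    by rewrite !blkE dyadicS ger0_norm// invr_ge0 exprn_ge0.
  move: h1 h2 h3 h4 h5 e1; rewrite !ler_norml; lra.
- by lra.
Qed.

End remainder.

(** * The harmonic functions atan ((x - a) / (y + e)) *)

(** On the range of [f] inversion agrees with the continuous map sending y to 1 / max(y, e). *)
Lemma measurable_funV_ge d (T : measurableType d) (R : realType) (f : T -> R)
    (e : R) : 0 < e -> (forall x, e <= f x) -> measurable_fun setT f ->
  measurable_fun setT (fun x => (f x)^-1).
Proof.
move=> e0 fe mf.
have -> : (fun x => (f x)^-1) = (fun y : R => (Num.max y e)^-1) \o f.
  by apply/funext => x /=; rewrite max_l.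
apply: measurableT_comp => //; apply: continuous_measurable_fun => x.
apply: cvgV; first by rewrite gt_eqF// lt_max e0 orbT.
by apply: continuous_max => //; exact: cvg_cst.
Qed.

Section atan_jet.
Context (R : realType).
Variables (e : R).
Hypothesis e0 : 0 < e.

Lemma atan_quotient_derive (u v h k s : R) : 0 < v + s * k ->
  is_derive s 1 (fun s => atan ((u + s * h) / (v + s * k)))
    ((v * h - u * k) / ((u + s * h) ^+ 2 + (v + s * k) ^+ 2)).
Proof.
move=> V0; have Vn0 : v + s * k != 0 by rewrite gt_eqF.
have dU : is_derive s 1 (fun s => u + s * h) h.
  by apply: is_derive_eq; rewrite scaler0 !add0r mul1r /GRing.scale/= mulr1.
have dV : is_derive s 1 (fun s => v + s * k) k.
  by apply: is_derive_eq; rewrite scaler0 !add0r mul1r /GRing.scale/= mulr1.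
have dVi := @is_deriveV _ (fun s : R => v + s * k) s _ _ Vn0 dV.
have dq : is_derive s 1 (fun s => (u + s * h) / (v + s * k))
    ((v * h - u * k) / (v + s * k) ^+ 2).
  apply: (@is_derive_eq _ _ _ _ _ _ _ _ (is_deriveM dU dVi)).
  by rewrite /GRing.scale/= expr2; field.
apply: (@is_derive_eq _ _ _ _ _ _ _ _ (@is_derive1_comp _ atan
  (fun s => (u + s * h) / (v + s * k)) _ _ _ (is_derive1_atan _) dq)).
by field; rewrite Vn0 andbT gt_eqF// ltr_wpDl ?sqr_ge0// exprn_gt0.
Qed.

Let kap := e^-1.
Let kap0 : 0 < kap. Proof. by rewrite invr_gt0. Qed.

(* [1 / (u + i v) = inv_re u v - i * inv_im u v]; the first and second partial
   derivatives of [atan (u / v)] are read off [1 / z] and [1 / z ^+ 2]. *)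
Definition inv_re (u v : R) := u / (u ^+ 2 + v ^+ 2).
Definition inv_im (u v : R) := v / (u ^+ 2 + v ^+ 2).

Let rho_gt0 (u v : R) : e <= v -> 0 < u ^+ 2 + v ^+ 2.
Proof.
move=> ev; rewrite ltr_wpDl ?sqr_ge0// exprn_gt0//; exact: lt_le_trans ev.
Qed.

Lemma inv_sqr u v : e <= v -> inv_re u v ^+ 2 + inv_im u v ^+ 2 <= kap ^+ 2.
Proof.
move=> ev; have r0 := rho_gt0 u ev.
have -> : inv_re u v ^+ 2 + inv_im u v ^+ 2 = (u ^+ 2 + v ^+ 2)^-1.
  by rewrite /inv_re /inv_im; field; rewrite gt_eqF.
rewrite /kap exprVn lef_pV2 ?posrE ?exprn_gt0//.
by rewrite ler_wpDl ?sqr_ge0// lerXn2r ?nnegrE ?(ltW e0)// (le_trans (ltW e0)).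
Qed.

Lemma inv_re_bound u v : e <= v -> `|inv_re u v| <= kap.
Proof.
move=> ev; rewrite -ler_sqr ?nnegrE ?(ltW kap0)// real_normK ?num_real//.
by rewrite (le_trans _ (inv_sqr u ev))// lerDl sqr_ge0.
Qed.

Lemma inv_im_bound u v : e <= v -> `|inv_im u v| <= kap.
Proof.
move=> ev; rewrite -ler_sqr ?nnegrE ?(ltW kap0)// real_normK ?num_real//.
by rewrite (le_trans _ (inv_sqr u ev))// lerDr sqr_ge0.
Qed.

(** Real and imaginary parts of 1/z - 1/z' = (z' - z) / (z z'), where both inverses have modulus at
    most [kap]. *)
Lemma inv_lip u v u' v' : e <= v -> e <= v' ->
  `|inv_re u v - inv_re u' v'| <= 2 * kap ^+ 2 * (`|u - u'| + `|v - v'|) /\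
  `|inv_im u v - inv_im u' v'| <= 2 * kap ^+ 2 * (`|u - u'| + `|v - v'|).
Proof.
move=> ev ev'; have r0 := rho_gt0 u ev; have r0' := rho_gt0 u' ev'.
set f := inv_re u v; set g := inv_im u v.
set f' := inv_re u' v'; set g' := inv_im u' v'.
have f1 : `|f| <= kap by exact: inv_re_bound.
have g1 : `|g| <= kap by exact: inv_im_bound.
have f1' : `|f'| <= kap by exact: inv_re_bound.
have g1' : `|g'| <= kap by exact: inv_im_bound.
have m1 (x y : R) : `|x| <= kap -> `|y| <= kap -> `|x * y| <= kap ^+ 2.
  by move=> hx hy; rewrite normrM expr2; apply: ler_pM.
have A1 : `|f * f' - g * g'| <= 2 * kap ^+ 2.
  have := m1 _ _ f1 f1'; have := m1 _ _ g1 g1'.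
  have := ler_normB (f * f') (g * g'); lra.
have A2 : `|f * g' + g * f'| <= 2 * kap ^+ 2.
  have := m1 _ _ f1 g1'; have := m1 _ _ g1 f1'.
  have := ler_normD (f * g') (g * f'); lra.
have E1 : f - f' = (f * f' - g * g') * (u' - u) + (f * g' + g * f') * (v' - v).
  by rewrite /f /f' /g /g' /inv_re /inv_im; field; rewrite !gt_eqF.
have E2 : g - g' = (f * g' + g * f') * (u' - u) - (f * f' - g * g') * (v' - v).
  by rewrite /f /f' /g /g' /inv_re /inv_im; field; rewrite !gt_eqF.
rewrite E1 E2 ![`|_ - u'|]distrC ![`|_ - v'|]distrC; split.
  apply: (le_trans (ler_normD _ _)); rewrite !normrM mulrDr.
  by apply: lerD; rewrite ler_wpM2r.
apply: (le_trans (ler_normB _ _)); rewrite !normrM mulrDr.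
by apply: lerD; rewrite ler_wpM2r.
Qed.

(** One constant for the whole jet: [kap] bounds the first derivatives, [2 * kap ^+ 2] the
    coefficients [a] and [b], and [24 * kap ^+ 3] their Lipschitz constants and the Taylor error. *)
Let c := 24 * kap ^+ 3 + 2 * kap ^+ 2 + kap.

Let k3_ge0 : 0 <= kap ^+ 3. Proof. by rewrite exprn_ge0// ltW. Qed.
Let k2_ge0 : 0 <= kap ^+ 2. Proof. exact: sqr_ge0. Qed.

(** For z = u + i v with v > 0, atan(u / v) is pi/2 minus the argument of z. With w = h + i k, the
    expansion w/(z + s w) = w/z - s w^2/z^2 + s^2 w^3/(z^2 (z + s w)) gives the derivative along the
    segment: the imaginary parts of the first two terms produce [L] and [2 * s * Q], and the last
    one is the error. The mean value theorem is applied to the difference [G]. *)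
Lemma atan_taylor u v h k : e <= v -> e <= v + k ->
  `|atan ((u + h) / (v + k)) - atan (u / v) - inv_im u v * h - (- inv_re u v) * k
    - (- (inv_re u v * inv_im u v) * (h ^+ 2 - k ^+ 2) +
      (inv_re u v ^+ 2 - inv_im u v ^+ 2) * (k * h))| <=
  24 * kap ^+ 3 * (`|h| + `|k|) * (h ^+ 2 + k ^+ 2).
Proof.
move=> ev ev'; set f := inv_re u v; set g := inv_im u v.
set L := g * h - f * k.
set Q := - (f * g) * (h ^+ 2 - k ^+ 2) + (f ^+ 2 - g ^+ 2) * (k * h).
have Ve (s : R) : 0 <= s <= 1 -> e <= v + s * k.
  move=> /andP[s0 s1]; rewrite (_ : v + s * k = (1 - s) * v + s * (v + k)).
    have : (1 - s) * e <= (1 - s) * v by rewrite ler_wpM2l// subr_ge0.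
    have : s * e <= s * (v + k) by rewrite ler_wpM2l.
    lra.
  by ring.
pose G (s : R) : R := atan ((u + s * h) / (v + s * k)) - (s * L + s ^+ 2 * Q).
pose G' (s : R) : R :=
  (v * h - u * k) / ((u + s * h) ^+ 2 + (v + s * k) ^+ 2) - (L + 2 * s * Q).
have dG (s : R) : 0 <= s <= 1 -> is_derive s 1 G (G' s).
  move=> s01; apply: is_deriveB.
    by apply: atan_quotient_derive; exact: lt_le_trans (Ve s s01).
  by apply: is_derive_eq; rewrite !scaler0 !add0r /GRing.scale/=; ring.
have cG : {within `[0, 1], continuous G}.
  apply: derivable_within_continuous => s; rewrite in_itv/= => s01.
  by have [] := dG s s01.
have [s] := MVT_segment (@ler01 R) (fun s (s01 : s \in `]0, 1[) => dG s (ltac:(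
  by move: s01; rewrite in_itv/= => /andP[/ltW -> /ltW ->]))) cG.
rewrite in_itv/= => s01.
have -> : G 1 - G 0 = atan ((u + h) / (v + k)) - atan (u / v) - g * h - - f * k - Q.
  by rewrite /G !mul1r !mul0r !addr0 expr1n expr0n/= /L; ring.
rewrite subr0 mulr1 => ->.
have Vs := Ve s s01; have rs := rho_gt0 (u + s * h) Vs; have r0 := rho_gt0 u ev.
set fs := inv_re (u + s * h) (v + s * k).
set gs := inv_im (u + s * h) (v + s * k).
(* In complex form 1/z^2 = c1 - i c2, 1/(z^2 (z + s w)) = d1 - i d2 and w^3 = p1 + i p2. *)
pose c1 := f ^+ 2 - g ^+ 2; pose c2 := 2 * f * g.
pose d1 := c1 * fs - c2 * gs; pose d2 := c1 * gs + c2 * fs.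
pose p1 := h ^+ 3 - 3 * h * k ^+ 2; pose p2 := 3 * h ^+ 2 * k - k ^+ 3.
have -> : G' s = - s ^+ 2 * (p2 * d1 - p1 * d2).
  rewrite /G' /L /Q /p1 /p2 /d1 /d2 /c1 /c2 /f /g /fs /gs /inv_re /inv_im.
  by field; rewrite !gt_eqF.
have fb : `|f| <= kap by exact: inv_re_bound.
have gb : `|g| <= kap by exact: inv_im_bound.
have fsb : `|fs| <= kap by exact: inv_re_bound.
have gsb : `|gs| <= kap by exact: inv_im_bound.
have kap_ge0 := ltW kap0.
clearbody f g fs gs.
have c1b : `|c1| <= 2 * kap ^+ 2.
  apply: (le_trans (ler_normB _ _)); rewrite !normrX.
  have : `|f| ^+ 2 <= kap ^+ 2 by rewrite lerXn2r.
  have : `|g| ^+ 2 <= kap ^+ 2 by rewrite lerXn2r.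
  lra.
have c2b : `|c2| <= 2 * kap ^+ 2.
  rewrite /c2 !normrM ger0_norm// -mulrA ler_wpM2l// expr2.
  exact: ler_pM.
have m3 (x y : R) : `|x| <= 2 * kap ^+ 2 -> `|y| <= kap -> `|x * y| <= 2 * kap ^+ 3.
  by move=> hx hy; rewrite normrM exprSr mulrA; apply: ler_pM.
have d1b : `|d1| <= 4 * kap ^+ 3.
  apply: (le_trans (ler_normB _ _)).
  have := m3 _ _ c1b fsb; have := m3 _ _ c2b gsb; lra.
have d2b : `|d2| <= 4 * kap ^+ 3.
  apply: (le_trans (ler_normD _ _)).
  have := m3 _ _ c1b gsb; have := m3 _ _ c2b fsb; lra.
set D := (`|h| + `|k|) * (h ^+ 2 + k ^+ 2).
have h2 := sqr_ge0 h; have k2 := sqr_ge0 k.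
have hk0 : 0 <= h ^+ 2 + k ^+ 2 by exact: addr_ge0.
have p1b : `|p1| <= 3 * D.
  rewrite (_ : p1 = h * (h ^+ 2 - 3 * k ^+ 2)); last by rewrite /p1; ring.
  rewrite normrM /D [leRHS]mulrCA; apply: ler_pM; rewrite ?lerDl//.
  by rewrite ler_norml; lra.
have p2b : `|p2| <= 3 * D.
  rewrite (_ : p2 = k * (3 * h ^+ 2 - k ^+ 2)); last by rewrite /p2; ring.
  rewrite normrM /D [leRHS]mulrCA; apply: ler_pM; rewrite ?lerDr//.
  by rewrite ler_norml; lra.
have pdb : `|p2 * d1 - p1 * d2| <= 24 * kap ^+ 3 * D.
  apply: (le_trans (ler_normB _ _)); rewrite !normrM.
  have := ler_pM (normr_ge0 p2) (normr_ge0 d1) p2b d1b.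
  have := ler_pM (normr_ge0 p1) (normr_ge0 d2) p1b d2b; lra.
rewrite -mulrA -/D normrM normrN -[leRHS]mul1r; apply: ler_pM => //.
move/andP: s01 => [s0 s1].
by rewrite ger0_norm ?sqr_ge0// expr_le1.
Qed.

Lemma atan_bound (x : R) : `|atan x| <= pi / 2.
Proof. by rewrite ler_norml !ltW ?atan_gtNpi2 ?atan_ltpi2. Qed.

Lemma measurable_inv_re_im (a : R) :
  measurable_fun setT (fun z : R * R => inv_re (z.1 - a) (`|z.2| + e)) /\
  measurable_fun setT (fun z : R * R => inv_im (z.1 - a) (`|z.2| + e)).
Proof.
have mu : measurable_fun setT (fun z : R * R => z.1 - a).
  by apply: measurable_funB => //; exact: measurable_fst.
have mv : measurable_fun setT (fun z : R * R => `|z.2| + e).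
  by apply: measurable_funD => //; apply: measurableT_comp.
have mr : measurable_fun setT
    (fun z : R * R => ((z.1 - a) ^+ 2 + (`|z.2| + e) ^+ 2)^-1).
  apply: (@measurable_funV_ge _ _ _ _ (e ^+ 2)); first by rewrite exprn_gt0.
    move=> z; rewrite ler_wpDl ?sqr_ge0// lerXn2r ?nnegrE ?(ltW e0)//.
      by rewrite addr_ge0// ltW.
    by rewrite lerDr.
  by apply: measurable_funD; exact: measurable_funX.
by split; exact: measurable_funM.
Qed.

(** The absolute value keeps the denominator at least [e] everywhere, since [M] is nonnegative only
    almost surely; the function is harmonic where y > 0. *)
Definition atan_half_plane (a x y : R) : R := atan ((x - a) / (`|y| + e)).

Lemma measurable_atan_half_plane a :
  measurable_fun setT (fun z : R * R => atan_half_plane a z.1 z.2).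
Proof.
apply: measurableT_comp.
  by apply: continuous_measurable_fun => x; exact: continuous_atan.
apply: measurable_funM.
  by apply: measurable_funB => //; exact: measurable_fst.
apply: (@measurable_funV_ge _ _ _ _ e) => //; first by move=> z; rewrite lerDr.
by apply: measurable_funD => //; apply: measurableT_comp.
Qed.

Lemma atan_half_plane_jet a : harmonic_jet (atan_half_plane a)
  (fun x y => inv_im (x - a) (`|y| + e)) (fun x y => - inv_re (x - a) (`|y| + e))
  (fun x y => - (inv_re (x - a) (`|y| + e) * inv_im (x - a) (`|y| + e)))
  (fun x y => inv_re (x - a) (`|y| + e) ^+ 2 - inv_im (x - a) (`|y| + e) ^+ 2)
  (pi / 2) c.
Proof.
have kap_ge0 := ltW kap0.
have ev (y : R) : e <= `|y| + e by rewrite lerDr.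
have k3 := k3_ge0; have k2 := k2_ge0.
have kapc : kap <= c by rewrite /c; lra.
have kap2c : 2 * kap ^+ 2 <= c by rewrite /c; lra.
have m1 (x y : R) : `|x| <= kap -> `|y| <= kap -> `|x * y| <= kap ^+ 2.
  by move=> hx hy; rewrite normrM expr2; apply: ler_pM.
have [mre mim] := measurable_inv_re_im a.
have lip (f g f' g' D : R) : `|f| <= kap -> `|g'| <= kap -> 0 <= D ->
    `|f - f'| <= 2 * kap ^+ 2 * D -> `|g - g'| <= 2 * kap ^+ 2 * D ->
    `|f * g - f' * g'| <= 4 * kap ^+ 3 * D.
  move=> hf hg D0 hff hgg.
  have -> : f * g - f' * g' = f * (g - g') + g' * (f - f') by ring.
  apply: (le_trans (ler_normD _ _)); rewrite !normrM.
  have k2D : 0 <= 2 * kap ^+ 2 * D by rewrite mulr_ge0// mulr_ge0.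
  have := ler_pM (normr_ge0 f) (normr_ge0 (g - g')) hf hgg.
  have := ler_pM (normr_ge0 g') (normr_ge0 (f - f')) hg hff.
  by rewrite [kap ^+ 3]exprS; lra.
split.
- by move=> x y; exact: atan_bound.
- by move=> x y; rewrite (le_trans _ kapc)// inv_im_bound.
- by move=> x y; rewrite normrN (le_trans _ kapc)// inv_re_bound.
- move=> x y; rewrite normrN.
  have := m1 _ _ (inv_re_bound (x - a) (ev y)) (inv_im_bound (x - a) (ev y)).
  lra.
- move=> x y; apply: (le_trans (ler_normB _ _)); rewrite !expr2.
  have := m1 _ _ (inv_re_bound (x - a) (ev y)) (inv_re_bound (x - a) (ev y)).
  have := m1 _ _ (inv_im_bound (x - a) (ev y)) (inv_im_bound (x - a) (ev y)).
  lra.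
- move=> x y x' y' y0 y'0.
  have [l1 l2] := inv_lip (x - a) (x' - a) (ev y) (ev y').
  rewrite (_ : x - a - (x' - a) = x - x') in l1 l2; last by ring.
  rewrite (_ : `|y| + e - (`|y'| + e) = y - y') in l1 l2; last first.
    by rewrite !ger0_norm//; ring.
  set D := `|x - x'| + `|y - y'| in l1 l2 *.
  have D0 : 0 <= D by rewrite addr_ge0.
  rewrite -opprD normrN.
  have := lip _ _ _ _ D (inv_re_bound (x - a) (ev y))
    (inv_im_bound (x' - a) (ev y')) D0 l1 l2.
  move=> /le_trans; apply; rewrite ler_wpM2r// /c; lra.
- move=> x y x' y' y0 y'0.
  have [l1 l2] := inv_lip (x - a) (x' - a) (ev y) (ev y').
  rewrite (_ : x - a - (x' - a) = x - x') in l1 l2; last by ring.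
  rewrite (_ : `|y| + e - (`|y'| + e) = y - y') in l1 l2; last first.
    by rewrite !ger0_norm//; ring.
  set D := `|x - x'| + `|y - y'| in l1 l2 *.
  have D0 : 0 <= D by rewrite addr_ge0.
  have h1 := lip _ _ _ _ D (inv_re_bound (x - a) (ev y))
    (inv_re_bound (x' - a) (ev y')) D0 l1 l1.
  have h2 := lip _ _ _ _ D (inv_im_bound (x - a) (ev y))
    (inv_im_bound (x' - a) (ev y')) D0 l2 l2.
  set f := inv_re _ _ in h1 *; set g := inv_im _ _ in h2 *.
  set f' := inv_re _ _ in h1 *; set g' := inv_im _ _ in h2 *.
  have -> : f ^+ 2 - g ^+ 2 - (f' ^+ 2 - g' ^+ 2) =
    (f * f - f' * f') - (g * g - g' * g') by ring.
  apply: (le_trans (ler_normB _ _)).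
  have : 8 * kap ^+ 3 * D <= c * D by rewrite ler_wpM2r// /c; lra.
  lra.
- move=> x y x' y' y0 y'0 /=; rewrite /atan_half_plane.
  rewrite !(ger0_norm y0) !(ger0_norm y'0).
  have ey : e <= y + e by rewrite lerDr.
  have ey' : e <= y + e + (y' - y).
    by rewrite (_ : _ + _ = y' + e) ?lerDr//; ring.
  have := atan_taylor (x - a) (x' - x) ey ey'.
  rewrite (_ : x - a + (x' - x) = x' - a); last by ring.
  rewrite (_ : y + e + (y' - y) = y' + e); last by ring.
  move=> /le_trans; apply; rewrite -[leLHS]mulrA -[leRHS]mulrA ler_wpM2r//; last first.
    by rewrite /c; lra.
  by rewrite mulr_ge0// addr_ge0// sqr_ge0.
- exact: measurable_atan_half_plane.
- exact: mim.
- exact: measurable_funN mre.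
Qed.

End atan_jet.

(** * From small exceptional probabilities to almost sure statements *)

Section measure_limits.
Context d (T : measurableType d) (R : realType) (P : probability T R).

Lemma probability_bigcup_le (E : nat -> set T) (e : R) :
  (forall n, measurable (E n)) -> (forall n, E n `<=` E n.+1) ->
  (forall n, (P (E n) <= e%:E)%E) -> (P (\bigcup_n E n) <= e%:E)%E.
Proof.
move=> mE ndE Ee; rewrite leNgt; apply/negP => eU.
have cv : P (E n) @[n --> \oo] --> P (\bigcup_n E n).
  apply: nondecreasing_cvg_mu => //; first exact: bigcup_measurable.
  move=> n m nm; apply/subsetPset; move: nm.
  by apply: homo_leq => [X w|X Y Z YX XZ w /YX/XZ|].
have [n _ /(_ n (leqnn n))] : \forall n \near \oo, (e%:E < P (E n))%E.
  by apply: (cv [set y | (e%:E < y)%E]); exact: open_ereal_gt'.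
by rewrite /= ltNge Ee.
Qed.

(** The index may change with [eta]: the exceptional sets for eta = 1/(n+1) intersect in a null set,
    and outside it some index works. *)
Lemma whp_exists_ae (I : Type) (Q : I -> T -> Prop) :
  (forall eta, 0 < eta -> exists m, whp P eta (Q m)) ->
  \forall w \ae P, exists m, Q m w.
Proof.
move=> h; have hn n : exists E : set T, [/\ measurable E,
    (P E <= (n.+1%:R^-1)%:E)%E & forall w, ~ E w -> exists m, Q m w].
  have [|m [E [mE PE EQ]]] := h n.+1%:R^-1; first by rewrite invr_gt0.
  by exists E; split => // w nE; exists m; exact: EQ.
have [E hE] := choice hn.
have mE n : measurable (E n) by case: (hE n).
have mI : measurable (\bigcap_n E n) by exact: bigcapT_measurable.
exists (\bigcap_n E n); split => //.
  apply/eqP; rewrite -measure_le0; apply/lee_addgt0Pr => e e0; rewrite add0e.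
  have [n ne] := ltr_add_invr e0; rewrite add0r in ne.
  have [_ PE _] := hE n.
  apply: (@le_trans _ _ (P (E n))).
    by apply: le_measure; rewrite ?inE//; exact: bigcap_inf.
  by rewrite (le_trans PE)// lee_fin ltW.
move=> w /= nQ n _; apply: contrapT => nE; apply: nQ.
by have [_ _] := hE n; apply.
Qed.

End measure_limits.

(** * Pathwise convergence criteria *)

Section deterministic_limits.
Context (R : realType).

Lemma dyadic_approx (t dl : R) : 0 <= t -> 0 < dl ->
  exists l j, t <= dyadic l j < t + dl.
Proof.
move=> t0 dl0; have [l ldl] := exp2V_small dl0.
have t20 : 0 <= t * 2 ^+ l by rewrite mulr_ge0// exprn_ge0.
have /andP[h1 h2] := truncn_itv t20.
exists l, (Num.truncn (t * 2 ^+ l)).+1.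
have p2 : 0 < 2 ^+ l :> R by rewrite exprn_gt0.
apply/andP; split; first by rewrite /dyadic ler_pdivlMr// ltW.
apply: le_lt_trans (_ : _ <= t + 2 ^- l) _; last by rewrite ltrD2l.
by rewrite /dyadic ler_pdivrMr// mulrDl mulVf ?gt_eqF// -natr1 lerD2r.
Qed.

(** Continuity extends the Cauchy criterion from the countably many dyadic times, where a maximal
    inequality can provide it, to all times. *)
Lemma cvg_pinfty_dyadic (z : R -> R) :
  {within `[0, +oo[, continuous z} ->
  (forall lam : R, 0 < lam -> exists m : nat, forall l j,
     m%:R <= dyadic l j :> R -> `|z (dyadic l j) - z m%:R| <= lam) ->
  cvg (z t @[t --> +oo]).
Proof.
move=> /subspace_continuousP cz h; apply/cauchy_cvgP; apply: cauchy_exP => e e0.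
have e20 : 0 < e / 3 by rewrite divr_gt0.
have [m hm] := h (e / 3) e20; exists (z m%:R).
exists m%:R; split; first exact: num_real.
move=> t mt /=; have t0 : 0 <= t by rewrite (le_trans _ (ltW mt)).
have := cz t; rewrite /= in_itv/= andbT => /(_ t0) /cvgrPdist_lt /(_ _ e20).
rewrite near_withinE => /nbhs_ballP[dl /= dl0 hd].
have [l [j /andP[tl lt]]] := dyadic_approx t0 dl0.
have h1 : `|z t - z (dyadic l j)| < e / 3.
  apply: hd; last by rewrite /= in_itv/= andbT dyadic_ge0.
  by rewrite /ball/= ler0_norm ?subr_le0//; lra.
have h2 := hm l j (le_trans (ltW mt) tl).
rewrite /ball/= distrC.
have := ler_distD (z (dyadic l j)) (z t) (z m%:R); lra.
Qed.

Lemma within_atan_half_plane (e a : R) (x y : R -> R) : 0 < e ->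
  {within `[0, +oo[, continuous x} -> {within `[0, +oo[, continuous y} ->
  {within `[0, +oo[, continuous (fun t => atan_half_plane e a (x t) (y t))}.
Proof.
move=> e0 /subspace_continuousP cx /subspace_continuousP cy.
apply/subspace_continuousP => t t0.
have q : (fun s => (x s - a) / (`|y s| + e)) @ within `[0, +oo[ (nbhs t) -->
    (x t - a) / (`|y t| + e).
  apply: cvgM; first by apply: cvgB; [exact: cx|exact: cvg_cst].
  apply: cvgV; first by rewrite gt_eqF// ltr_wpDl.
  by apply: cvgD; [apply: cvg_norm; exact: cy|exact: cvg_cst].
exact: (continuous_cvg _ (@continuous_atan R _) q).
Qed.

(* A limit [+- pi / 2] of the angle is excluded by the times at which [x] is
   bounded by [K]. *)
Lemma atan_half_plane_cvg_unbounded (x y : R -> R) (K : R) :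
  cvg (atan_half_plane 1 0 (x t) (y t) @[t --> +oo]) ->
  y t @[t --> +oo] --> (0 : R) ->
  (forall n0 : nat, exists2 n : nat, (n0 <= n)%N & `|x n%:R| < K) ->
  cvg (x t @[t --> +oo]).
Proof.
move=> /cvg_ex[/= l zl] y0 xK.
have zE t : atan_half_plane 1 0 (x t) (y t) = atan (x t / (`|y t| + 1)).
  by rewrite /atan_half_plane subr0.
have K0 : 0 <= K by have [n _ h] := xK 0%N; rewrite ltW// (le_lt_trans _ h).
(* The denominator is at least 1, so at the times where [x] is below [K] in absolute value the
   quotient is too. *)
have lK : `|l| <= atan K.
  apply/ler_addgt0Pr => e e0.
  move/cvgrPdist_lt: zl => /(_ e e0) [B0 [_ hB]].
  have [n nB] : exists n : nat, B0 < n%:R.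
    by exists (Num.bound `|B0|); rewrite (le_lt_trans (ler_norm _))// archi_boundP.
  have [k nk xk] := xK n.
  have := hB k%:R (lt_le_trans nB _); rewrite ler_nat => /(_ nk); rewrite zE.
  set q := x _ / _ => h.
  have qK : `|q| <= K.
    rewrite normrM normfV [`| _ + 1|]ger0_norm; last by rewrite addr_ge0.
    rewrite ler_pdivrMr ?ltr_wpDl// (le_trans (ltW xk))// mulrDr mulr1 lerDr.
    by rewrite mulr_ge0.
  have : `|atan q| <= atan K.
    move: qK; rewrite !ler_norml -atanN => /andP[h1 h2].
    by rewrite !le_atan.
  have := ler_distD (atan q) l 0; rewrite !subr0; lra.
have lpi : `|l| < pi / 2 by rewrite (le_lt_trans lK)// atan_ltpi2.
have cl : cos l != 0.
  by rewrite gt_eqF// cos_gt0_pihalf// -ltr_norml.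
(* Since [l] stays away from the poles of [tan], [x] is recovered as the tangent of the angle times
   [|y| + 1], and the second factor tends to 1. *)
have h1 : tan (atan_half_plane 1 0 (x t) (y t)) @[t --> +oo] --> tan l.
  by apply: continuous_cvg => //; exact: continuous_tan.
have h2 : `|y t| + 1 @[t --> +oo] --> `|0 : R| + 1.
  by apply: cvgD; [exact: cvg_norm|exact: cvg_cst].
have := cvgM h1 h2; rewrite normr0 add0r mulr1 => h3.
apply/cvg_ex; exists (tan l).
rewrite [X in X --> _](_ : _ = (fun t =>
  tan (atan_half_plane 1 0 (x t) (y t)) * (`|y t| + 1)) @ +oo); first exact: h3.
apply: (congr1 (fun f : R -> R => f @ +oo)); apply/funext => t.
by rewrite zE atanK divfK// gt_eqF// ltr_wpDl.
Qed.

End deterministic_limits.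

(** * The Cauchy law *)

Section cauchy_measure.
Context (R : realType).
Local Notation mu := (@lebesgue_measure R).

Section positive_scale.
Variable c : R.
Hypothesis c0 : 0 < c.

Let den_gt0 (x : R) : 0 < pi * c * (1 + (x / c) ^+ 2).
Proof. by rewrite !mulr_gt0 ?pi_gt0// ltr_wpDr ?sqr_ge0. Qed.

Lemma cauchy_pdf_ge0 x : 0 <= cauchy_pdf c x.
Proof. by rewrite invr_ge0 ltW. Qed.

Lemma continuous_cauchy_pdf : continuous (cauchy_pdf c).
Proof.
move=> x; apply: cvgV; first by rewrite gt_eqF.
apply: cvgM; first exact: cvg_cst.
apply: cvgD; first exact: cvg_cst.
rewrite expr2; apply: cvgM; apply: cvgM; by [exact: cvg_id|exact: cvg_cst].
Qed.

Lemma measurable_cauchy_pdf : measurable_fun setT (cauchy_pdf c).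
Proof. by apply: continuous_measurable_fun; exact: continuous_cauchy_pdf. Qed.

Let cdf (x : R) : R := atan (x / c) / pi.

Lemma is_derive_cauchy_cdf (x : R) : is_derive x 1 cdf (cauchy_pdf c x).
Proof.
have d1 : is_derive x 1 (fun x : R => x / c) c^-1.
  by apply: is_derive_eq; rewrite scaler0 add0r /GRing.scale/= mulr1.
have d2 := @is_derive1_comp _ atan (fun x : R => x / c) _ _ _ (is_derive1_atan _) d1.
have d3 : is_derive x 1 (fun x : R => atan (x / c)) ((1 + (x / c) ^+ 2)^-1 * c^-1).
  exact: d2.
apply: is_derive_eq; rewrite scaler0 add0r /GRing.scale/= /cauchy_pdf.
by rewrite !invfM; ring.
Qed.

Lemma integral_cauchy_pdf_tail (a : R) :
  (\int[mu]_(x in `[a, +oo[) (cauchy_pdf c x)%:E = (1 / 2 - atan (a / c) / pi)%:E)%E.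
Proof.
have cc x : {for x, continuous cdf}.
  by apply/differentiable_continuous/derivable1_diffP; have [] := is_derive_cauchy_cdf x.
rewrite (@ge0_continuous_FTC2y _ _ cdf _ (1 / 2)) ?EFinB//.
- by move=> x _; exact: cauchy_pdf_ge0.
- by apply: continuous_subspaceT => x; exact: continuous_cauchy_pdf.
- have -> : 1 / 2 = pi / 2 / pi :> R by rewrite mulrAC mulfV ?gt_eqF ?pi_gt0.
  apply: cvgM; last exact: cvg_cst.
  apply: (cvg_comp _ _ _ (@cvgy_atan R)).
  by apply: gt0_cvgMly; rewrite ?invr_gt0.
- by apply: cvg_at_right_filter; exact: cc.
- by move=> x _; rewrite derive1E; have [_ ->] := is_derive_cauchy_cdf x.
Qed.

End positive_scale.

Let cauchy_law_npos (c : R) : ~~ (0 < c) -> cauchy_law c = \d_(0 : R).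
Proof. by move=> /negbTE c0; apply/funext => B; rewrite /cauchy_law c0. Qed.

Let cauchy_law0 (c : R) : cauchy_law c set0 = 0%E.
Proof.
by have [c0|/cauchy_law_npos->] := boolP (0 < c);
  rewrite ?measure0// /cauchy_law c0 integral_set0.
Qed.

Let cauchy_law_ge0 (c : R) A : (0 <= cauchy_law c A)%E.
Proof.
have [c0|/cauchy_law_npos->//] := boolP (0 < c).
by rewrite /cauchy_law c0 integral_ge0// => x _; rewrite lee_fin cauchy_pdf_ge0.
Qed.

Let cauchy_law_sigma_additive (c : R) : semi_sigma_additive (cauchy_law c).
Proof.
have [c0|/cauchy_law_npos->] := boolP (0 < c); last exact: measure_semi_sigma_additive.
move=> /= F mF tF mUF; rewrite /cauchy_law c0; apply: cvg_toP.
  apply: ereal_nondecreasing_is_cvgn => m n mn.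
  apply: lee_sum_nneg_natr => // k _ _; apply: integral_ge0 => /= x Fkx.
  by rewrite lee_fin cauchy_pdf_ge0.
rewrite ge0_integral_bigcup//=.
- by apply/measurable_funTS/measurableT_comp => //; exact: measurable_cauchy_pdf.
- by move=> x _; rewrite lee_fin cauchy_pdf_ge0.
Qed.

(** The measure structure supplies the difference formula and the continuity from below used in the
    pi-lambda argument. *)
HB.instance Definition _ (c : R) := isMeasure.Build _ _ _
  (cauchy_law c) (cauchy_law0 c) (@cauchy_law_ge0 c) (@cauchy_law_sigma_additive c).

Lemma cauchy_law_tail (c a : R) : 0 < c ->
  cauchy_law c `[a, +oo[%classic = (1 / 2 - atan (a / c) / pi)%:E.
Proof. by move=> c0; rewrite /cauchy_law c0 integral_cauchy_pdf_tail. Qed.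

Lemma cauchy_law_setT (c : R) : cauchy_law c setT = 1%E.
Proof.
have [c0|/cauchy_law_npos->] := boolP (0 < c); last by rewrite diracT.
pose A (n : nat) : set R := `[- n%:R, +oo[%classic.
have AT : \bigcup_n A n = setT.
  apply/seteqP; split => // x _; exists (Num.bound `|x|) => //.
  rewrite /A /= in_itv/= andbT lerNl (le_trans _ (ltW (archi_boundP _)))//.
  by rewrite -normrN ler_norm.
have cv : cauchy_law c (A n) @[n --> \oo] --> cauchy_law c setT.
  rewrite -AT; apply: nondecreasing_cvg_mu => //.
  - by move=> n; exact: measurable_itv.
  - by rewrite AT.
  - move=> n m nm; apply/subsetPset => x; rewrite /A /= !in_itv/= !andbT.
    by apply: le_trans; rewrite lerN2 ler_nat.
have cv1 : cauchy_law c (A n) @[n --> \oo] --> (1 / 2 + pi / 2 / pi : R)%:E.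
  have -> : (fun n => cauchy_law c (A n)) =
      (fun n : nat => (1 / 2 + atan (n%:R / c) / pi)%:E).
    apply/funext => n; rewrite /A cauchy_law_tail// mulNr atanN mulNr opprK.
    by [].
  have h : (fun n : nat => 1 / 2 + atan (n%:R / c) / pi) @ \oo -->
      (1 / 2 + pi / 2 / pi : R).
    apply: cvgD; first exact: cvg_cst.
    apply: cvgM; last exact: cvg_cst.
    apply: (cvg_comp _ _ _ (@cvgy_atan R)).
    apply: (cvg_comp _ (fun x : R => x / c) (@cvgr_idn R)).
    by apply: gt0_cvgMly; rewrite ?invr_gt0.
  by apply: cvg_EFin; first exact: nearW.
rewrite -(cvg_lim (@ereal_hausdorff R) cv) (cvg_lim (@ereal_hausdorff R) cv1); congr (_%:E).
by rewrite [pi / 2 / pi]mulrAC mulfV ?gt_eqF ?pi_gt0//; lra.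
Qed.

Lemma cauchy_law_le1 (c : R) A : measurable A -> (cauchy_law c A <= 1)%E.
Proof.
by move=> mA; rewrite -(cauchy_law_setT c); apply: le_measure; rewrite ?inE.
Qed.

End cauchy_measure.

(** * Conditional laws determined by tails, and limits of the angles *)

Section conditional_law.
Context d (T : measurableType d) (R : realType) (P : probability T R).

(* pi-lambda theorem with the generators [`[a, +oo[]. *)
Lemma cond_law_cauchy_of_tails (X Z : {RV P >-> R}) :
  (forall a : R, measurable_fun setT (fun c : R => cauchy_law c `[a, +oo[%classic)) ->
  (forall (a : R) A, measurable A -> P ((X @^-1` A) `&` (Z @^-1` `[a, +oo[)) =
    (\int[P]_(w in X @^-1` A) cauchy_law (X w) `[a, +oo[%classic)%E) ->
  is_cond_law X Z (@cauchy_law R).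
Proof.
move=> mK lawK.
pose H (B : set R) := [/\ measurable B,
  measurable_fun setT (fun c : R => cauchy_law c B) &
  forall A, measurable A -> P ((X @^-1` A) `&` (Z @^-1` B)) =
    (\int[P]_(w in X @^-1` A) cauchy_law (X w) B)%E].
have mpre (Y : {RV P >-> R}) A : measurable A -> measurable (Y @^-1` A).
  by move=> mA; rewrite -[X in measurable X]setTI; exact: measurable_funPT.
have mKX B (D : set T) : measurable_fun setT (fun c : R => cauchy_law c B) ->
    measurable D -> measurable_fun D (fun w => cauchy_law (X w) B).
  move=> mKB mD; apply: measurable_funTS.
  by apply: (measurableT_comp mKB); exact: measurable_funPT.
(* Finiteness is what allows subtraction in the closure under proper differences. *)
have finK c B : measurable B -> cauchy_law c B \is a fin_num.
  by move=> mB; rewrite ge0_fin_numE// (le_lt_trans (cauchy_law_le1 c mB))// ltry.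
suff HB B : measurable B -> H B.
  split => [B mB|A B mA mB]; first by have [_] := HB B mB.
  by have [_ _] := HB B mB; apply.
rewrite [X in X B -> _](_ : _ = <<s @RGenCInfty.G R >>); last first.
  by rewrite -[RHS]RGenCInfty.measurableE.
move: B; apply: (@lambda_system_subset _ _ _ setT) => //.
- move=> _ _ [a ->] [b ->]; exists (Num.max a b).
  apply/seteqP; split => x /=; rewrite !in_itv/= !andbT ge_max.
    by move=> [-> ->].
  by move=> /andP[].
- split => //.
  + split => //; first by under eq_fun do rewrite cauchy_law_setT; exact: measurable_cst.
    move=> A mA; under eq_integral do rewrite cauchy_law_setT.
    by rewrite preimage_setT setIT integral_cst ?mul1e//; exact: mpre.
  + move=> A B BA [mA mKA lA] [mB mKB lB].
    have KD c : cauchy_law c (A `\` B) = (cauchy_law c A - cauchy_law c B)%E.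
      rewrite measureD// ?setIidr//.
      by rewrite (le_lt_trans (cauchy_law_le1 c mA))// ltry.
    have mKD : measurable_fun setT (fun c : R => cauchy_law c (A `\` B)).
      by under eq_fun do rewrite KD; exact: emeasurable_funB.
    have mAB : measurable (A `\` B) by exact: measurableD.
    split => // E mE; have mXE := mpre X E mE.
    have := lA E mE.
    have -> : X @^-1` E `&` Z @^-1` A =
        (X @^-1` E `&` Z @^-1` B) `|` (X @^-1` E `&` Z @^-1` (A `\` B)).
      by rewrite -setIUr -preimage_setU setDUK.
    have -> : P ((X @^-1` E `&` Z @^-1` B) `|` (X @^-1` E `&` Z @^-1` (A `\` B))) =
        (P (X @^-1` E `&` Z @^-1` B) + P (X @^-1` E `&` Z @^-1` (A `\` B)))%E.
      apply: measureU; try by apply: measurableI => //; exact: mpre.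
      by apply/seteqP; split => // w /= [[_ Bw] [_ [_]]].
    rewrite (lB E mE) (_ : (\int[P]_(w in X @^-1` E) cauchy_law (X w) A)%E =
      (\int[P]_(w in X @^-1` E)
        (cauchy_law (X w) B + cauchy_law (X w) (A `\` B)))%E); last first.
      by apply: eq_integral => w _; rewrite KD addeC subeK// finK.
    rewrite ge0_integralD//; [|exact: mKX|exact: mKX].
    have fB : (\int[P]_(w in X @^-1` E) cauchy_law (X w) B)%E \is a fin_num.
      by rewrite -lB// fin_num_measure//; apply: measurableI => //; exact: mpre.
    set I := (\int[P]_(w in _) cauchy_law (X w) B)%E in fB * => IE.
    have := congr1 (fun z => z - I)%E IE.
    by rewrite /= ![(I + _)%E]addeC !addeK.
  + move=> B ndB HB.
    have mB i : measurable (B i) by case: (HB i).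
    have mU : measurable (\bigcup_i B i) by exact: bigcup_measurable.
    have cK c : cauchy_law c (B n) @[n --> \oo] --> cauchy_law c (\bigcup_i B i).
      exact: nondecreasing_cvg_mu.
    split => //.
      apply: (emeasurable_fun_cvg (fun n c => cauchy_law c (B n))) => //.
      by move=> n; case: (HB n).
    move=> E mE; have mXE := mpre X E mE.
    have cP : P (X @^-1` E `&` Z @^-1` B n) @[n --> \oo] -->
        P (X @^-1` E `&` Z @^-1` (\bigcup_i B i)).
      rewrite preimage_bigcup setI_bigcupr; apply: nondecreasing_cvg_mu.
      * by move=> n; apply: measurableI => //; exact: mpre.
      * by apply: bigcup_measurable => n _; apply: measurableI => //; exact: mpre.
      * move=> n m nm; apply/subsetPset; apply: setIS; apply: preimage_subset.
        by apply/subsetPset/ndB.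
    have cI : (\int[P]_(w in X @^-1` E) cauchy_law (X w) (B n))%E @[n --> \oo] -->
        (\int[P]_(w in X @^-1` E) cauchy_law (X w) (\bigcup_i B i))%E.
      rewrite [X in _ --> X](_ : _ = (\int[P]_(w in X @^-1` E)
          (limn (fun n => cauchy_law (X w) (B n))))%E); last first.
        by apply: eq_integral => w _; apply/esym/cvg_lim => //; exact: cK.
      apply: cvg_monotone_convergence => //.
      * by move=> n; apply: mKX => //; case: (HB n).
      * move=> w _ n m nm; apply: le_measure; rewrite ?inE//.
        by apply/subsetPset/ndB.
    rewrite -(cvg_lim (@ereal_hausdorff R) cP) -(cvg_lim (@ereal_hausdorff R) cI).
    by congr (limn _); apply/funext => n; case: (HB n) => _ _; apply.
- by move=> _ [a ->]; split => //; exact: lawK.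
Qed.

Lemma expect_cvg (f_ : nat -> T -> R) (f : T -> R) (C : R) :
  (forall n, measurable_fun setT (f_ n)) -> measurable_fun setT f ->
  (forall n w, `|f_ n w| <= C) ->
  (\forall w \ae P, f_ n w @[n --> \oo] --> f w) ->
  expect P (f_ n) @[n --> \oo] --> expect P f.
Proof.
move=> mf_ mf fC ff.
have [] := @dominated_convergence _ _ _ P setT measurableT
  (fun n w => (f_ n w)%:E) (fun w => (f w)%:E) (cst C%:E).
- by move=> n; exact/measurable_EFinP.
- exact/measurable_EFinP.
- apply: filterS ff => w h _; apply: cvg_EFin => //; exact: nearW.
- exact: intble_cst.
- by apply: aeW => w n _; rewrite lee_fin.
move=> fi _ h; apply: fine_cvg; rewrite /expect /Rintegral fineK//.
exact: (integrable_fin_num _ fi).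
Qed.

(** The level rises to [a] from below more slowly than the height falls to 0, so a mass at [a]
    itself is counted in [a, +oo[. Such a mass is possible: the law is the point mass at 0 when the
    scale vanishes. *)
Definition level_shift (a : R) (k : nat) : R := a - k.+1%:R^-1.
Definition height_shift (k : nat) : R := k.+1%:R ^- 2.

Lemma height_shift_gt0 k : 0 < height_shift k.
Proof. by rewrite invr_gt0 exprn_gt0. Qed.

Definition half_line_sign (a x : R) : R := if a <= x then pi / 2 else - (pi / 2).

Lemma atan_ge_cvg (u : nat -> R) : (\forall n \near \oo, n%:R <= u n) ->
  atan (u n) @[n --> \oo] --> (pi / 2 : R).
Proof.
move=> nu; apply: (cvg_comp _ _ _ (@cvgy_atan R)).
exact: (ger_cvgy nu (@cvgr_idn R)).
Qed.

(* [(x - a_k) / e_k = (x - a) (k+1)^2 + (k+1)], so the limit at [x = a] is [pi / 2]. *)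
Lemma atan_seq_cvg (a x : R) :
  atan ((x - level_shift a k) / height_shift k) @[k --> \oo] --> half_line_sign a x.
Proof.
have E k : (x - level_shift a k) / height_shift k = (x - a) * k.+1%:R ^+ 2 + k.+1%:R.
  by rewrite /level_shift /height_shift; field.
rewrite /half_line_sign; case: ifPn => ax.
  apply: atan_ge_cvg; apply: nearW => k; rewrite E.
  rewrite (@le_trans _ _ k.+1%:R)// ?ler_nat// lerDr mulr_ge0//; by rewrite subr_ge0.
rewrite -ltNge in ax.
rewrite [X in X @ _](_ : _ =
    (fun k => - atan (- ((x - level_shift a k) / height_shift k)))); last first.
  by apply/funext => k; rewrite atanN opprK.
apply: cvgN; apply: atan_ge_cvg.
have ax0 : 0 < a - x by rewrite subr_gt0.
have := archi_boundP (divr_ge0 (ler0n R 2) (ltW ax0)); set m := Num.bound _ => hm.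
exists m => // k /= mk; rewrite E.
have h1 : 2 <= (a - x) * k.+1%:R.
  have : 2 / (a - x) <= k.+1%:R.
    by rewrite (le_trans (ltW hm))// ler_nat ltnW.
  by rewrite ler_pdivrMr// mulrC.
have h2 : 2 * k.+1%:R <= (a - x) * k.+1%:R * k.+1%:R by rewrite ler_wpM2r.
have h3 : k%:R <= k.+1%:R :> R by rewrite ler_nat.
rewrite expr2; lra.
Qed.

Lemma level_shift_cvg (a : R) : level_shift a k @[k --> \oo] --> a.
Proof.
rewrite -[X in _ --> X]subr0; apply: cvgB; first exact: cvg_cst.
exact: cvg_harmonic.
Qed.

Lemma height_shift_cvg : height_shift k @[k --> \oo] --> (0 : R).
Proof.
rewrite [X in X @ _](_ : _ = (fun k => k.+1%:R^-1 * k.+1%:R^-1)); last first.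
  by apply/funext => k; rewrite /height_shift -exprVn expr2.
by rewrite -[X in _ --> X](mulr0 0); apply: cvgM; exact: cvg_harmonic.
Qed.

(** For c > 0 the limit is atan(- a / c), which the explicit tail turns into this affine form.
    Otherwise [Num.max c 0] is 0 and the limit is that of [atan_seq_cvg] at x = 0, in agreement with
    the point mass. *)
Lemma atan_init_cvg (a c : R) :
  atan (- level_shift a k / (Num.max c 0 + height_shift k)) @[k --> \oo] -->
  (pi * fine (cauchy_law c `[a, +oo[%classic) - pi / 2 : R).
Proof.
have pi0 : pi != 0 :> R by rewrite gt_eqF// pi_gt0.
have [c0|c0] := ltP 0 c.
  rewrite cauchy_law_tail//=.
  have -> : pi * (1 / 2 - atan (a / c) / pi) - pi / 2 = atan (- a / (c + 0)) :> R.
    have gen (p x : R) : p != 0 -> p * (1 / 2 - x / p) - p / 2 = - x.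
      by move=> p0; field.
    by rewrite addr0 mulNr atanN gen.
  apply: continuous_cvg; first exact: continuous_atan.
  apply: cvgM; first by apply: cvgN; exact: level_shift_cvg.
  apply: cvgV; first by rewrite addr0 gt_eqF.
  by apply: cvgD; [exact: cvg_cst|exact: height_shift_cvg].
have -> : pi * fine (cauchy_law c `[a, +oo[%classic) - pi / 2 = half_line_sign a 0 :> R.
  rewrite /cauchy_law ltNge c0/= indicE /half_line_sign.
  case: ifPn => a0.
    by rewrite mem_set/= ?in_itv/= ?andbT//; lra.
  by rewrite memNset/= ?in_itv/= ?andbT ?(negbTE a0)//; lra.
rewrite [X in X @ _](_ : _ = (fun k => atan ((0 - level_shift a k) / height_shift k))).
  exact: atan_seq_cvg.
by apply/funext => k; rewrite add0r sub0r.
Qed.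

Lemma cauchy_law_tail_fin (c a : R) :
  (fine (cauchy_law c `[a, +oo[%classic))%:E = cauchy_law c `[a, +oo[%classic.
Proof.
rewrite fineK// ge0_fin_numE//.
by rewrite (le_lt_trans (cauchy_law_le1 c (measurable_itv _)))// ltry.
Qed.

(** By [atan_init_cvg] an affine image of the tail is a pointwise limit of measurable functions of
    [c]. *)
Lemma measurable_cauchy_law_tail (a : R) :
  measurable_fun setT (fun c : R => cauchy_law c `[a, +oo[%classic).
Proof.
have mg : measurable_fun setT
    (fun c : R => pi * fine (cauchy_law c `[a, +oo[%classic) - pi / 2).
  apply: (@measurable_fun_cvg _ _ _ setT (fun k (c : R) =>
    atan (- level_shift a k / (Num.max c 0 + height_shift k)))); last first.
    by move=> c _; exact: atan_init_cvg.
  move=> k; apply: measurableT_comp.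
    by apply: continuous_measurable_fun => x; exact: continuous_atan.
  apply: measurable_funM => //.
  apply: (@measurable_funV_ge _ _ _ _ (height_shift k)); first exact: height_shift_gt0.
    by move=> x; rewrite lerDr le_max lexx orbT.
  by apply: measurable_funD => //; exact: measurable_maxr.
under eq_fun do rewrite -cauchy_law_tail_fin; apply/measurable_EFinP.
rewrite [X in measurable_fun _ X](_ : _ = (fun c : R => pi^-1 *
  (pi * fine (cauchy_law c `[a, +oo[%classic) - pi / 2 + pi / 2))).
  by apply: measurable_funM => //; exact: measurable_funD.
apply/funext => c; rewrite subrK mulrA mulVf ?mul1r//.
by rewrite gt_eqF// pi_gt0.
Qed.

End conditional_law.

(** * Convergence and limit law *)

Section half_plane_martingale.
Context d (T : measurableType d) (R : realType) (P : probability T R).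
Local Notation dyadic := (@dyadic R).

Variable F : R -> set (set T).
Hypothesis F_filt : is_filtration F.

Lemma filtration_sigma t : 0 <= t -> sigma_algebra setT (F t).
Proof. by move=> t0; have [/(_ t t0)[]] := F_filt. Qed.

Lemma filtration_measurable t : 0 <= t -> F t `<=` measurable.
Proof. by move=> t0; have [/(_ t t0)[]] := F_filt. Qed.

Lemma filtration_mono s t : 0 <= s -> s <= t -> F s `<=` F t.
Proof. by have [_] := F_filt; apply. Qed.

Section martingale_facts.
Variable X : R -> {RV P >-> R}.
Hypothesis X_mart : is_martingale F X.

Lemma martingale_intble t : 0 <= t -> intble P (X t).
Proof. by case: X_mart => _ h _ /h. Qed.

Lemma martingale_adapted t : 0 <= t -> adapted_to (F t) (X t).
Proof.
move=> t0; apply: measurable_wrt_adapted; first exact: filtration_sigma.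
by case: X_mart => h _ _; exact: h.
Qed.

Lemma martingale_expect s t A : 0 <= s -> s <= t -> F s A ->
  expect P (fun w => \1_A w * X s w) = expect P (fun w => \1_A w * X t w).
Proof.
move=> s0 st FA; have mA := filtration_measurable s0 FA.
rewrite !expect_indicM// /Rintegral.
by case: X_mart => _ _ /(_ s t s0 st)[_ _ /(_ A FA) ->].
Qed.

End martingale_facts.

Variables (M N QM QN QMN : R -> {RV P >-> R}).
Hypothesis M_mart : is_continuous_martingale F M.
Hypothesis N_mart : is_continuous_martingale F N.
Hypothesis QM_def : is_quadratic_variation M QM.
Hypothesis QN_def : is_quadratic_variation N QN.
Hypothesis QMN_def : is_quadratic_covariation M N QMN.
Hypothesis QM_eq_QN : \forall w \ae P, forall t, 0 <= t -> QM t w = QN t w.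
Hypothesis QMN_eq0 : \forall w \ae P, forall t, 0 <= t -> QMN t w = 0.
Hypothesis M_ge0 : \forall w \ae P, forall t, 0 <= t -> 0 <= M t w.
Hypothesis M_cvg0 : \forall w \ae P, M t w @[t --> +oo] --> (0 : R).
Hypothesis N_0 : \forall w \ae P, N 0 w = 0.

(** * The bounded martingale attached to a jet and its almost sure Cauchy property *)

Section jet_martingale.
Variables (phi px py a b : R -> R -> R) (B c : R).
Hypothesis jet : harmonic_jet phi px py a b B c.

Lemma measurable_comp_pair (f : R -> R -> R) G (X Y : T -> R) :
  measurable_fun setT (fun z : R * R => f z.1 z.2) ->
  adapted_to G X -> adapted_to G Y -> adapted_to G (fun w => f (X w) (Y w)).
Proof.
move=> mf mX mY.
exact: (measurableT_comp mf (measurable_fun_pair mX mY)).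
Qed.

Lemma jet_adapted t : 0 <= t -> adapted_to (F t) (fun w => phi (N t w) (M t w)).
Proof.
move=> t0; apply: measurable_comp_pair; first exact: jet_meas jet.
  exact: martingale_adapted N_mart.1 _ _.
exact: martingale_adapted M_mart.1 _ _.
Qed.

(** The left side does not depend on the subdivision, so it suffices to bound it by every e > 0.
    First [K] makes the passage of |N| + |M| above it improbable, then the remainder is made small
    off an event whose probability is small relative to [K], and [stopped_estimate] concludes. *)
Lemma jet_martingale m0 a0 b0 A : (a0 <= b0)%N -> F (dyadic m0 a0) A ->
  expect P (fun w => \1_A w *
    (phi (N (dyadic m0 b0) w) (M (dyadic m0 b0) w) -
     phi (N (dyadic m0 a0) w) (M (dyadic m0 a0) w))) = 0.
Proof.
move=> ab FA; set s := dyadic m0 a0 in FA *; set t := dyadic m0 b0.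
have c0 := jet_c_ge0 jet; have B0 := jet_B_ge0 jet.
have t0 : 0 <= t by exact: dyadic_ge0.
pose Wt w := `|N t w| + `|M t w|.
have Wi : intble P Wt.
  apply: intbleD; apply: intble_norm.
    exact: martingale_intble N_mart.1 _ _.
  exact: martingale_intble M_mart.1 _ _.
have W0 w : 0 <= Wt w by rewrite addr_ge0.
set EW := expect P Wt; have EW0 : 0 <= EW by exact: expect_ge0.
apply/eqP; rewrite -normr_le0; apply/ler_addgt0Pr => e e0; rewrite add0r.
(* Each of the four terms of [stopped_estimate] receives a quarter of [e]. *)
pose dt := e / 4; have dt0 : 0 < dt by rewrite divr_gt0.
have [dl dl0 Hdl] := intble_abs_continuous Wi W0
  (divr_gt0 dt0 (ltr_wpDl (mulr_ge0 (ler0n R 3) c0) ltr01)).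
(* By Doob [K * P(B1) <= EW]. The second summand, made strict by the 1, gives [P(B1) < dl]; the
   third gives [(4 * B + 1) * P(B1) <= dt]. *)
pose K := 1 + EW / dl + (4 * B + 1) * EW / dt.
have k1 : 0 <= EW / dl by rewrite divr_ge0// ltW.
have k2 : 0 <= (4 * B + 1) * EW / dt.
  by rewrite divr_ge0// ?(ltW dt0)// mulr_ge0//; lra.
have K1 : 1 <= K by rewrite /K; lra.
have K0 : 0 <= K by lra.
pose e1 := Num.min 1 dt.
have e10 : 0 < e1 by rewrite lt_min ltr01.
have e11 : e1 <= 1 by rewrite ge_min lexx.
have e1dt : e1 <= dt by rewrite ge_min lexx orbT.
have cK0 : 0 <= c * K by rewrite mulr_ge0.
have den0 : 0 < 4 * B + 1 + 2 * c * K by lra.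
(* The tolerance is [e1 / 2] because the remainder from [s] on is a difference of two sums started
   at time 0. *)
have [l ml [Bd [mBd PBd HBd]]] := whp_remainder M_mart.2 N_mart.2 QM_def QN_def
  QMN_def QM_eq_QN QMN_eq0 M_ge0 jet m0 b0 (divr_gt0 e10 (ltr0n R 2))
  (divr_gt0 dt0 den0).
pose p := (2 ^ (l - m0))%N.
pose aa := (a0 * p)%N; pose n := ((b0 - a0) * p)%N.
have sE : s = dyadic l (aa + 0) by rewrite addn0 /s (dyadic_refine _ _ ml).
have tE : t = dyadic l (aa + n).
  by rewrite /aa /n -mulnDl subnKC// /t (dyadic_refine _ _ ml).
have le_t i j : (i <= j)%N -> dyadic l (aa + i) <= dyadic l (aa + j).
  by move=> ij; rewrite le_dyadic leq_add2l.
have d0 i : 0 <= dyadic l (aa + i) by exact: dyadic_ge0.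
pose G i := F (dyadic l (aa + i)).
have sG i : sigma_algebra setT (G i) by exact: filtration_sigma.
have Gm i : G i `<=` measurable by exact: filtration_measurable.
have Gmono i j : (i <= j)%N -> G i `<=` G j.
  by move=> ij; apply: filtration_mono => //; exact: le_t.
pose X i : T -> R := N (dyadic l (aa + i)); pose Y i : T -> R := M (dyadic l (aa + i)).
have Xi i : intble P (X i) by exact: martingale_intble N_mart.1 _ _.
have Yi i : intble P (Y i) by exact: martingale_intble M_mart.1 _ _.
have Xa i : adapted_to (G i) (X i) by exact: martingale_adapted N_mart.1 _ _.
have Ya i : adapted_to (G i) (Y i) by exact: martingale_adapted M_mart.1 _ _.
have Xm : closed_mart P G X n.
  move=> i E ni GE; apply: martingale_expect N_mart.1 _ _ _ _ _ _ => //.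
  exact: le_t.
have Ym : closed_mart P G Y n.
  move=> i E ni GE; apply: martingale_expect M_mart.1 _ _ _ _ _ _ => //.
  exact: le_t.
have pa i : adapted_to (G i) (fun w => px (X i w) (Y i w)).
  by apply: measurable_comp_pair => //; exact: jet_meas_px jet.
have qa i : adapted_to (G i) (fun w => py (X i w) (Y i w)).
  by apply: measurable_comp_pair => //; exact: jet_meas_py jet.
have mU i : measurable_fun setT (fun w => phi (X i w) (Y i w)).
  exact: (measurableT_comp (jet_meas jet) (measurable_fun_pair _ _)).
have GA : G 0 A by rewrite /G -sE.
have dev w : ~ Bd w -> forall k, (k <= n)%N -> `|phi (X k w) (Y k w) -
    phi (X 0 w) (Y 0 w) - transform X Y (fun i w => px (X i w) (Y i w))
      (fun i w => py (X i w) (Y i w)) k w| <= e1.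
  move=> nB k kn.
  pose r := jet_rem phi px py (fun j => N (dyadic l j) w) (fun j => M (dyadic l j) w).
  have -> : phi (X k w) (Y k w) - phi (X 0 w) (Y 0 w) -
      transform X Y (fun i w => px (X i w) (Y i w))
      (fun i w => py (X i w) (Y i w)) k w =
      \sum_(0 <= j < aa + k) r j - \sum_(0 <= j < aa) r j.
    rewrite (big_cat_nat (leq0n aa) (leq_addr k aa))/= [RHS]addrAC subrr add0r.
    rewrite -{1}[aa]add0n big_addn addKn big_mkord /transform.
    elim: k {kn} => [|k IH]; first by rewrite !big_ord0 !subrr.
    rewrite !big_ord_recr/= -IH /r /jet_rem /transform_step /X /Y.
    by rewrite [(k + aa)%N]addnC -addnS; ring.
  have h1 := HBd w nB (aa + k)%N.
  have h2 := HBd w nB aa.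
  have nE : (aa + n = b0 * 2 ^ (l - m0))%N by rewrite /aa /n -mulnDl subnKC.
  rewrite -nE leq_add2l in h1; rewrite -nE leq_addr in h2.
  have := ler_normB (\sum_(0 <= j < aa + k) r j) (\sum_(0 <= j < aa) r j).
  have := h1 kn; have := h2 isT; rewrite -/r; lra.
have := @stopped_estimate _ _ _ P G sG Gm Gmono X Y
  (fun i w => phi (X i w) (Y i w)) (fun i w => px (X i w) (Y i w))
  (fun i w => py (X i w) (Y i w)) n B c Xi Yi Xa Ya Xm Ym pa qa
  (fun i w => jet_px jet _ _) (fun i w => jet_py jet _ _) mU
  (fun i w => jet_bound jet _ _) A Bd e1 K (ltW e10) e11 K0 GA mBd dev.
set W := fun (i : nat) (w : T) => `|X i w| + `|Y i w|.
set B1 := exceeds _ K n.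
have WnE : W n = Wt by rewrite /W /X /Y -tE.
have -> : expect P (fun w => \1_A w * (phi (X n w) (Y n w) - phi (X 0 w) (Y 0 w)))
   = expect P (fun w => \1_A w * (phi (N t w) (M t w) - phi (N s w) (M s w))).
  by rewrite /X /Y -tE -sE.
rewrite (_ : expect P (fun w => \1_B1 w * (`|X n w| + `|Y n w|)) =
             expect P (fun w => \1_B1 w * Wt w)); last first.
  by rewrite -WnE.
have Wa i : adapted_to (G i) (W i).
  by apply: measurable_funD; apply: measurableT_comp => //; [exact: Xa|exact: Ya].
have Wint i : intble P (W i) by apply: intbleD; exact: intble_norm.
have mB1 : measurable B1 by exact: (measurable_exceeds sG).
have doob : K * fine (P B1) <= expect P (fun w => \1_B1 w * Wt w).
  rewrite -WnE; apply: (doob_maximal sG Gm Gmono) => //.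
    by move=> w; rewrite addr_ge0.
  apply: (@closed_submartD _ _ _ _ _ _ (fun i w => `|X i w|) (fun i w => `|Y i w|)) => //.
  - by move=> i; exact: intble_norm.
  - by move=> i; exact: intble_norm.
  - exact: (closed_submart_norm sG).
  - exact: (closed_submart_norm sG).
have EB : expect P (fun w => \1_B1 w * Wt w) <= EW.
  apply: le_expect => //; first exact: intble_indicM.
  by move=> w; rewrite -[leRHS]mul1r ler_wpM2r// (le_trans (ler_norm _))// normr_indic.
have PB0 : 0 <= fine (P B1) by exact: fineP_ge0.
have PB1dl : fine (P B1) < dl.
  have [B1dl|//] := leP dl (fine (P B1)); exfalso.
  have : K * dl <= K * fine (P B1) by rewrite ler_wpM2l.
  have : EW / dl * dl = EW by rewrite divfK// gt_eqF.
  have : 0 <= (4 * B + 1) * EW / dt * dl by rewrite mulr_ge0// ltW.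
  have : K * dl = dl + EW / dl * dl + (4 * B + 1) * EW / dt * dl.
    by rewrite /K !mulrDl mul1r.
  lra.
have T1 : (4 * B + 1) * fine (P B1) <= dt.
  have KB : K * fine (P B1) <= EW by exact: le_trans doob EB.
  have hB : 0 <= 4 * B + 1 by lra.
  have := ler_wpM2l hB KB.
  have : (4 * B + 1) * EW = (4 * B + 1) * EW / dt * dt by rewrite divfK// gt_eqF.
  set z := (4 * B + 1) * EW / dt in k2 *; move=> -> h.
  have : (4 * B + 1) * ((1 + z) * fine (P B1)) <= z * dt.
    apply: le_trans h; rewrite ler_wpM2l// ler_wpM2r// /K /z; lra.
  have zz : 0 < 1 + z by lra.
  rewrite -(ler_pM2l zz); nra.
have T2 : (4 * B + 1 + 2 * c * K) * fine (P Bd) <= dt.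
  have : fine (P Bd) <= dt / (4 * B + 1 + 2 * c * K).
    by rewrite -lee_fin fineP_fin.
  by rewrite ler_pdivlMr// mulrC.
have T3 : 3 * c * expect P (fun w => \1_B1 w * Wt w) <= dt.
  have h := Hdl B1 mB1 PB1dl.
  have E0 : 0 <= expect P (fun w => \1_B1 w * Wt w).
    by apply: expect_ge0 => w; rewrite mulr_ge0.
  by move: h; rewrite ler_pdivlMr ?ltr_wpDl ?mulr_ge0//; lra.
move=> /le_trans; apply; rewrite /dt in e1dt T1 T2 T3; lra.
Qed.

Let Z t w : R := phi (N t w) (M t w).

Let Z_adapted t : 0 <= t -> adapted_to (F t) (Z t).
Proof. exact: (jet_adapted). Qed.

Let Z_meas t : 0 <= t -> measurable_fun setT (Z t).
Proof.
move=> t0; apply: (@adapted_measurable _ _ _ (F t)).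
- exact: filtration_sigma.
- exact: filtration_measurable.
- exact: Z_adapted.
Qed.

Let Z_int t : 0 <= t -> intble P (Z t).
Proof.
move=> t0; apply: (@intble_bounded _ _ _ _ _ B); first exact: Z_meas.
by move=> w; exact: jet_bound jet _ _.
Qed.

Lemma jet_martingale_nat (m n : nat) A : (m <= n)%N -> F m%:R A ->
  expect P (fun w => \1_A w * (Z n%:R w - Z m%:R w)) = 0.
Proof.
move=> mn; have := jet_martingale (m0 := 0) mn.
by rewrite !dyadic0; exact.
Qed.

(** Orthogonality of increments: [Z m] is bounded and measurable at time [m], so the cross term
    vanishes. *)
Lemma jet_energy (m n : nat) : (m <= n)%N ->
  expect P (fun w => (Z n%:R w - Z m%:R w) ^+ 2) =
  expect P (fun w => Z n%:R w ^+ 2) - expect P (fun w => Z m%:R w ^+ 2).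
Proof.
move=> mn; have B0 := jet_B_ge0 jet.
have sqi (k : nat) : intble P (fun w => Z k%:R w ^+ 2).
  apply: (@intble_bounded _ _ _ _ _ (B ^+ 2)).
    by apply: measurable_funX; exact: Z_meas.
  by move=> w; rewrite normrX lerXn2r ?nnegrE//; exact: jet_bound jet _ _.
have di : intble P (fun w => Z n%:R w - Z m%:R w).
  by apply: intbleB; exact: Z_int.
have h0 : expect P (fun w => Z m%:R w * (Z n%:R w - Z m%:R w)) = 0.
  apply: (@expect_adaptedM_eq0 _ _ _ _ (F m%:R) _ _ B) => //.
  - exact: filtration_sigma.
  - exact: filtration_measurable.
  - exact: Z_adapted.
  - by move=> w; exact: jet_bound jet _ _.
  - by move=> A; exact: jet_martingale_nat.
have hi : intble P (fun w => Z m%:R w * (Z n%:R w - Z m%:R w)).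
  apply: (@intbleM _ _ _ _ _ _ B) => //; first exact: Z_meas.
  by move=> w; exact: jet_bound jet _ _.
rewrite (eq_expect _ (g := fun w => Z n%:R w ^+ 2 - Z m%:R w ^+ 2
   - 2 * (Z m%:R w * (Z n%:R w - Z m%:R w)))); last by move=> w; ring.
rewrite expectB; [|exact: intbleB|exact: intbleZ].
by rewrite expectB// expectZ// h0 mulr0 subr0.
Qed.

Lemma jet_energy_cauchy (e : R) : 0 < e -> exists m : nat,
  forall n : nat, (m <= n)%N -> expect P (fun w => (Z n%:R w - Z m%:R w) ^+ 2) <= e.
Proof.
move=> e0; apply: contrapT => /forallNP h.
have step m : exists n : nat, (m <= n)%N /\
    expect P (fun w => Z m%:R w ^+ 2) + e < expect P (fun w => Z n%:R w ^+ 2).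
  have /existsNP[n /not_implyP[mn /negP]] := h m.
  rewrite -ltNge jet_energy// => hn; exists n; split => //; lra.
have [f hf] := choice step.
(* If the claim failed, each application of [f] would raise the second moment by at least [e],
   beyond the bound [B ^+ 2]. *)
have grow k : k%:R * e <= expect P (fun w => Z (iter k f 0%N)%:R w ^+ 2).
  elim: k => [|k IH]; first by rewrite mul0r; apply: expect_ge0 => w; exact: sqr_ge0.
  have [_ /=] := hf (iter k f 0%N).
  by rewrite -natr1 mulrDl mul1r; lra.
have B2 : 0 <= B ^+ 2 by exact: sqr_ge0.
have ub (n : nat) : expect P (fun w => Z n%:R w ^+ 2) <= B ^+ 2.
  rewrite -[leRHS](expect_cst P); apply: le_expect.
  - apply: (@intble_bounded _ _ _ _ _ (B ^+ 2)).
      by apply: measurable_funX; exact: Z_meas.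
    move=> w; rewrite normrX lerXn2r ?nnegrE ?(jet_B_ge0 jet)//.
    exact: jet_bound jet _ _.
  - exact: intble_cst.
  - move=> w; rewrite -real_normK ?num_real//.
    by rewrite lerXn2r ?nnegrE ?(jet_B_ge0 jet)//; exact: jet_bound jet _ _.
have p0 : 0 <= B ^+ 2 / e by rewrite divr_ge0// ltW.
have := archi_boundP p0; set k := Num.bound _ => hk.
have := le_trans (grow k) (ub _); rewrite -ler_pdivlMr//.
by rewrite leNgt hk.
Qed.

(** Small energy after [m] gives a small first absolute moment, and Doob's inequality on the level
    [n] grid of [m, m + n] a bound uniform in [n]. These grids increase to the set of all dyadic
    times after [m]. *)
Lemma jet_maximal (lam eta : R) : 0 < lam -> 0 < eta -> exists m : nat,
  whp P eta (fun w => forall l j, m%:R <= dyadic l j ->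
    `|Z (dyadic l j) w - Z m%:R w| <= lam).
Proof.
move=> lam0 eta0; pose th := lam * eta / 2.
have th0 : 0 < th by rewrite divr_gt0// mulr_gt0.
have thE : th + th = lam * eta by rewrite /th; lra.
clearbody th.
have [m hm] := jet_energy_cauchy (mulr_gt0 th0 th0); exists m.
have L1 (n : nat) : (m <= n)%N -> expect P (fun w => `|Z n%:R w - Z m%:R w|) <= lam * eta.
  move=> mn; have di : intble P (fun w => Z n%:R w - Z m%:R w).
    by apply: intbleB; exact: Z_int.
  have d2i : intble P (fun w => (Z n%:R w - Z m%:R w) ^+ 2).
    apply: (@intble_bounded _ _ _ _ _ ((B + B) ^+ 2)).
      by apply: measurable_funX; exact: intble_measurable di.
    move=> w; rewrite normrX lerXn2r ?nnegrE//.
      by have B0 := jet_B_ge0 jet; rewrite addr_ge0.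
    rewrite (le_trans (ler_normB _ _))// lerD//; exact: jet_bound jet _ _.
  (* Pointwise |y| <= th + y^2 / th; as the energy is at most th^2, the mean is at most
     [th + th = lam * eta]. *)
  apply: (@le_trans _ _ (expect P (fun w => th + th^-1 * (Z n%:R w - Z m%:R w) ^+ 2))).
    apply: le_expect; first exact: intble_norm.
      by apply: intbleD; [exact: intble_cst|exact: intbleZ].
    move=> w; set y := Z n%:R w - Z m%:R w.
    have := sqr_ge0 (`|y| - th); rewrite sqrrB real_normK ?num_real// => h.
    rewrite -(ler_pM2l th0) mulrDr mulrA mulfV ?gt_eqF// mul1r.
    have := mulr_ge0 (ltW th0) (normr_ge0 y).
    by rewrite expr2 in h; lra.
  rewrite expectD; [|exact: intble_cst|exact: intbleZ].
  rewrite expect_cst expectZ//.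
  have := hm n mn; rewrite -(ler_pM2l (_ : 0 < th^-1)) ?invr_gt0//.
  by rewrite mulrA mulVf ?gt_eqF// mul1r; lra.
pose tm n i := dyadic n (m * 2 ^ n + i).
have tm0 n i : 0 <= tm n i by exact: dyadic_ge0.
have tm_m n : tm n 0 = m%:R.
  by rewrite /tm addn0 -(@dyadic0 R m) (dyadic_refine R m (leq0n n)) subn0.
have tm_n n : tm n (n * 2 ^ n)%N = (m + n)%:R.
  by rewrite /tm -mulnDl -(@dyadic0 R (m + n)) (dyadic_refine R (m + n) (leq0n n)) subn0.
have le_tm n i j : (i <= j)%N -> tm n i <= tm n j.
  by move=> ij; rewrite le_dyadic leq_add2l.
pose W n i w := `|Z (tm n i) w - Z m%:R w|.
pose E n := exceeds (W n) lam (n * 2 ^ n)%N.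
have GE n : measurable (E n) /\ (P (E n) <= eta%:E)%E.
  pose G i := F (tm n i).
  have sG i : sigma_algebra setT (G i) by exact: filtration_sigma.
  have Gm i : G i `<=` measurable by exact: filtration_measurable.
  have Gmono i j : (i <= j)%N -> G i `<=` G j.
    by move=> ij; apply: filtration_mono => //; exact: le_tm.
  pose X i w := Z (tm n i) w - Z m%:R w.
  have Xi i : intble P (X i) by apply: intbleB; exact: Z_int.
  have Xa i : adapted_to (G i) (X i).
    apply: measurable_funB; first exact: Z_adapted.
    apply: (adaptedS (sG 0%N) (sG i) (Gmono _ _ (leq0n i))).
    by rewrite /G tm_m; exact: Z_adapted.
  have Xm : closed_mart P G X (n * 2 ^ n)%N.
    move=> i A ni GA; have mA := Gm _ _ GA; apply/eqP; rewrite eq_sym -subr_eq0.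
    rewrite -expectB; [|exact: intble_indicM|exact: intble_indicM].
    rewrite (eq_expect _ (g := fun w => \1_A w *
      (Z (tm n (n * 2 ^ n)%N) w - Z (tm n i) w))); last by move=> w; rewrite /X; ring.
    apply/eqP; apply: (jet_martingale) => //.
    by rewrite leq_add2l.
  have Wi i : intble P (W n i) by move: (Xi i) => /intble_norm.
  have Wa i : adapted_to (G i) (W n i).
    by apply: measurableT_comp => //; exact: Xa.
  have mE : measurable (E n) by exact: (measurable_exceeds sG).
  split => //.
  have Ws : closed_submart P G (W n) (n * 2 ^ n)%N by exact: (closed_submart_norm sG).
  have := doob_maximal sG Gm Gmono lam Wi Wa (fun w => normr_ge0 _) Ws.
  rewrite -/(E n) => h.
  have h2 : expect P (fun w => \1_(E n) w * W n (n * 2 ^ n)%N w) <= lam * eta.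
    apply: le_trans (L1 (m + n)%N (leq_addr _ _)).
    rewrite -tm_n; apply: le_expect; first exact: intble_indicM.
      exact: Wi.
    move=> w; rewrite -[leRHS]mul1r; apply: ler_wpM2r => //.
    exact: normr_ge0.
  by rewrite -fineP_fin// lee_fin -(ler_pM2l lam0); exact: le_trans h h2.
have ndE n : E n `<=` E n.+1.
  move=> w [i ni Wi]; exists (i * 2)%N.
    by rewrite expnS mulnA mulnAC leq_mul2r /= (leq_trans ni)// leq_mul2r leqnSn orbT.
  move: Wi; rewrite /W; congr (_ < `|Z _ w - _|).
  rewrite /tm (dyadic_refine R (m * 2 ^ n + i) (leqnSn n)) subSnn expn1.
  by rewrite mulnDl -mulnA -expnSr.
exists (\bigcup_n E n); split.
- by apply: bigcup_measurable => n _; exact: (GE n).1.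
- by apply: probability_bigcup_le => // n; [exact: (GE n).1|exact: (GE n).2].
move=> w nE l j mlj; rewrite leNgt; apply/negP => lt; apply: nE.
have ln : (l <= l + j)%N by exact: leq_addr.
(* Level [l + j] is fine enough to contain the time [dyadic l j], and its horizon [m + l + j] is
   late enough because [dyadic l j <= j]. *)
exists (l + j)%N => //; exists (j * 2 ^ (l + j - l) - m * 2 ^ (l + j))%N.
  rewrite leq_subLR -mulnDl addKn; apply: leq_mul.
    by rewrite addnA leq_addl.
  by rewrite leq_pexp2l// leq_addl.
rewrite /W /tm subnKC -?dyadic_refine//.
by rewrite -(@le_dyadic R (l + j)) -dyadic_refine// -(tm_m (l + j)%N) /tm addn0 in mlj *.
Qed.

Lemma jet_cauchy_ae : \forall w \ae P, forall lam, 0 < lam -> exists m : nat,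
  forall l j, m%:R <= dyadic l j -> `|Z (dyadic l j) w - Z m%:R w| <= lam.
Proof.
have h n : \forall w \ae P, exists m : nat, forall l j, m%:R <= dyadic l j ->
    `|Z (dyadic l j) w - Z m%:R w| <= n.+1%:R^-1.
  by apply: whp_exists_ae => eta eta0; apply: jet_maximal; rewrite ?invr_gt0.
have := ae_foralln h; apply: filterS => w hw lam lam0.
have [n] := ltr_add_invr lam0; rewrite add0r => nlam.
have [m hm] := hw n; exists m => l j mlj.
by rewrite (le_trans (hm l j mlj))// ltW.
Qed.

End jet_martingale.

(** * Tightness and almost sure convergence of N *)

Lemma measurable_atan_hp (e a : R) (X Y : T -> R) : 0 < e ->
  measurable_fun setT X -> measurable_fun setT Y ->
  measurable_fun setT (fun w => atan_half_plane e a (X w) (Y w)).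
Proof.
move=> e0 mX mY.
exact: (measurableT_comp (measurable_atan_half_plane e0 a) (measurable_fun_pair mX mY)).
Qed.

Lemma intble_atan_hp (e a : R) (X Y : {RV P >-> R}) : 0 < e ->
  intble P (fun w => atan_half_plane e a (X w) (Y w)).
Proof.
move=> e0; apply: (@intble_bounded _ _ _ _ _ (pi / 2)).
  exact: measurable_atan_hp.
by move=> w; exact: atan_bound.
Qed.

Lemma measurable_atan_init (e b : R) : 0 < e ->
  measurable_fun setT (fun w => atan (b / (`|M 0 w| + e))).
Proof.
move=> e0; apply: measurableT_comp.
  by apply: continuous_measurable_fun => x; exact: continuous_atan.
apply: measurable_funM => //; apply: (@measurable_funV_ge _ _ _ _ e) => //.
  by move=> w; rewrite lerDr.
by apply: measurable_funD => //; exact: measurableT_comp.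
Qed.

Lemma intble_atan_init (e b : R) : 0 < e ->
  intble P (fun w => atan (b / (`|M 0 w| + e))).
Proof.
move=> e0; apply: (@intble_bounded _ _ _ _ _ (pi / 2)).
  exact: measurable_atan_init.
by move=> w; exact: atan_bound.
Qed.

(* [N 0 = 0] turns the initial value of the martingale into a function of [M 0]. *)
Lemma expect_atan_hp (e a : R) (n : nat) A : 0 < e -> F 0 A ->
  expect P (fun w => \1_A w * atan_half_plane e a (N n%:R w) (M n%:R w)) =
  expect P (fun w => \1_A w * atan (- a / (`|M 0 w| + e))).
Proof.
move=> e0 FA; have mA := filtration_measurable (lexx 0) FA.
have := jet_martingale_nat (atan_half_plane_jet e0 a) (leq0n n) FA.
rewrite (eq_expect _ (fun w => mulrBr (\1_A w) _ _)) expectB; last 2 first.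
- by apply: intble_indicM => //; exact: intble_atan_hp.
- by apply: intble_indicM => //; exact: intble_atan_hp.
move=> /eqP; rewrite subr_eq0 => /eqP ->; apply: ae_eq_expect.
- by apply: measurable_funM => //; exact: measurable_atan_hp.
- by apply: measurable_funM => //; exact: measurable_atan_init.
- by apply: filterS N_0 => w /= N0; rewrite /atan_half_plane N0 sub0r.
Qed.

(** Seen from a far level the initial angle is close to - pi / 2, uniformly where [M 0] is bounded.
    The exceptional event costs at most [pi] times its probability, whence the choice
    [et = eta / (1 + pi)]. *)
Lemma atan_tail (eta : R) : 0 < eta -> exists2 a : R, 0 < a &
  expect P (fun w => atan (- a / (`|M 0 w| + 1)) + pi / 2) <= eta.
Proof.
move=> eta0; pose et := eta / (1 + pi).
have pi0 : 0 < pi :> R by exact: pi_gt0.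
have et0 : 0 < et by rewrite divr_gt0// ltr_pwDr.
have [K K0 [E [mE PE EK]]] := whp_bounded (M 0) et0.
have K1 : 0 < K + 1 by rewrite ltr_wpDl.
have [a a0 ha] : exists2 a : R, 0 < a & pi / 2 - et <= atan (a / (K + 1)).
  have /cvgrPdist_lt /(_ et et0) [B [_ hB]] := @cvgy_atan R.
  pose b := Num.max 1 (B + 1).
  have b0 : 0 < b by rewrite lt_max ltr01.
  have Bb : B < b by rewrite lt_max ltrDl ltr01 orbT.
  exists (b * (K + 1)); first by rewrite mulr_gt0.
  rewrite mulfK ?gt_eqF//; have := hB b Bb => /ltW.
  by rewrite ler_norml => /andP[_]; lra.
exists a => //.
have i1 : intble P (fun w => atan (- a / (`|M 0 w| + 1)) + pi / 2).
  by apply: intbleD; [exact: intble_atan_init|exact: intble_cst].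
apply: (@le_trans _ _ (expect P (fun w => et + pi * \1_E w))).
  apply: le_expect => //.
    by apply: intbleD; [exact: intble_cst|apply: intbleZ; exact: intble_indic].
  move=> w; rewrite indicE; have [wE|wE] := boolP (w \in E).
    by rewrite mulr1; have := atan_ltpi2 (- a / (`|M 0 w| + 1)); lra.
  rewrite mulr0 addr0 mulNr atanN.
  have MK : `|M 0 w| <= K by apply: EK => Ew; move/negP: wE; apply; exact: mem_set.
  have : atan (a / (K + 1)) <= atan (a / (`|M 0 w| + 1)).
    apply: le_atan; rewrite ler_pM2l// lef_pV2 ?posrE ?ltr_wpDl//.
    by rewrite lerD2r.
  lra.
rewrite expectD; [|exact: intble_cst|by apply: intbleZ; exact: intble_indic].
rewrite expect_cst expectZ ?expect_indic//; last exact: intble_indic.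
have : fine (P E) <= et by rewrite -lee_fin fineP_fin.
rewrite -(ler_pM2l pi0).
have : et * (1 + pi) = eta by rewrite divfK// gt_eqF// ltr_pwDr.
lra.
Qed.

Lemma measurable_ge_set (f : T -> R) (a : R) : measurable_fun setT f ->
  measurable [set w | a <= f w].
Proof.
move=> mf; rewrite (_ : [set w | _] = f @^-1` `[a, +oo[).
  by rewrite -[X in measurable X]setTI; exact: mf.
by apply/seteqP; split => w /=; rewrite in_itv/= andbT.
Qed.

(** Markov's inequality for the nonnegative variable [s * ph + pi / 2], which is at least [pi / 2]
    on the event and has the same mean as at time 0. The sign [s] selects the upper or the lower
    tail. *)
Lemma N_tail_half (s eta a : R) (n : nat) : s = 1 \/ s = -1 ->
  expect P (fun w => atan (- a / (`|M 0 w| + 1)) + pi / 2) <= eta * (pi / 4) ->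
  fine (P [set w | a <= s * N n%:R w]) <= eta / 2.
Proof.
move=> s1 ha; set S := [set w | _].
have s2 : s * s = 1 by case: s1 => ->; rewrite ?mulrNN mulr1.
have atanS (x : R) : s * atan x = atan (s * x).
  by case: s1 => ->; rewrite ?mul1r// !mulN1r atanN.
have mS : measurable S by apply: measurable_ge_set; exact: measurable_funM.
have FT : F 0 setT.
  case: (filtration_sigma (lexx (0 : R))) => h0 hC _.
  by rewrite -(setD0 setT); exact: hC.
pose ph w := atan_half_plane 1 (s * a) (N n%:R w) (M n%:R w).
have phi : intble P ph by exact: intble_atan_hp.
have E1 : expect P (fun w => s * ph w) =
    expect P (fun w => atan (- a / (`|M 0 w| + 1))).
  have FE (f : T -> R) : expect P (fun w => \1_setT w * f w) = expect P f.
    by apply: eq_expect => w; rewrite indicT mul1r.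
  have := expect_atan_hp (s * a) n (@ltr01 R) FT; rewrite !FE => phE.
  rewrite expectZ// /ph phE -expectZ; last exact: intble_atan_init.
  apply: eq_expect => w; rewrite atanS; congr atan.
  by rewrite mulrA mulrN mulrA s2 mul1r.
have E2 : expect P (fun w => pi / 2 * \1_S w) <= expect P (fun w => s * ph w + pi / 2).
  apply: le_expect; first by apply: intbleZ; exact: intble_indic.
    by apply: intbleD; [exact: intbleZ|exact: intble_cst].
  move=> w; rewrite indicE /ph /atan_half_plane atanS.
  have [wS|wS] := boolP (w \in S).
    rewrite mulr1 lerDr.
    have aS : a <= s * N n%:R w by exact: (set_mem wS).
    rewrite -(@atan0 R) le_atan// mulrA mulrBr mulrA s2 mul1r.
    by rewrite divr_ge0// ?subr_ge0.
  rewrite mulr0 -lerBlDr sub0r.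
  by rewrite ltW// atan_gtNpi2.
rewrite expectZ ?expect_indic// in E2; last exact: intble_indic.
rewrite expectD ?E1 in E2; [|exact: intbleZ|exact: intble_cst].
rewrite -expectD in E2; [|exact: intble_atan_init|exact: intble_cst].
have pi20 : 0 < pi / 2 :> R by rewrite divr_gt0// pi_gt0.
by rewrite -(ler_pM2l pi20) (le_trans E2)// (le_trans ha)//; lra.
Qed.

Lemma N_tail (eta : R) : 0 < eta -> exists2 a : R, 0 < a &
  forall n : nat, (P [set w | (a <= `|N n%:R w|)%R] <= eta%:E)%E.
Proof.
move=> eta0.
have pi4 : 0 < pi / 4 :> R by rewrite divr_gt0// pi_gt0.
have [a a0 ha] := atan_tail (mulr_gt0 eta0 pi4).
exists a => // n.
have hp := @N_tail_half 1 eta a n (or_introl erefl) ha.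
have hn := @N_tail_half (-1) eta a n (or_intror erefl) ha.
have mp : measurable [set w | a <= 1 * N n%:R w].
  by apply: measurable_ge_set; exact: measurable_funM.
have mn : measurable [set w | a <= -1 * N n%:R w].
  by apply: measurable_ge_set; exact: measurable_funM.
apply: (@le_trans _ _ (P ([set w | a <= 1 * N n%:R w] `|` [set w | a <= -1 * N n%:R w]))).
  apply: le_measure; rewrite ?inE//.
  - by apply: measurable_ge_set; exact: measurableT_comp.
  - exact: measurableU.
  - by move=> w /=; rewrite mul1r mulN1r ler_normr => /orP.
apply: (le_trans (measureU2 _ _ _)) => //.
have := lerD hp hn; rewrite -lee_fin EFinD !fineP_fin//.
by move=> /le_trans; apply; rewrite lee_fin; lra.
Qed.

(** The event that [|N n| >= a] for all large [n] is an increasing union of events, each of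
    probability at most [eta] by tightness. *)
Lemma N_bounded_often : \forall w \ae P, exists K : R,
  forall n0 : nat, exists2 n : nat, (n0 <= n)%N & `|N n%:R w| < K.
Proof.
apply: whp_exists_ae => eta eta0; have [a a0 ha] := N_tail eta0.
exists a; pose E n0 := \bigcap_(n in [set n | (n0 <= n)%N]) [set w | a <= `|N n%:R w|].
have m1 (n : nat) : measurable [set w | a <= `|N n%:R w|].
  by apply: measurable_ge_set; exact: measurableT_comp.
have mE n : measurable (E n) by apply: bigcap_measurableType.
exists (\bigcup_n E n); split; first exact: bigcup_measurable.
  apply: probability_bigcup_le => //.
    by move=> n w En k /= nk; apply: En; exact: ltnW.
  move=> n; apply: (@le_trans _ _ (P [set w | a <= `|N n%:R w|])) => //.
  by apply: le_measure; rewrite ?inE//; apply: bigcap_inf => /=.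
move=> w nE n0; apply: contrapT => h; apply: nE; exists n0 => // n /= nn.
by rewrite leNgt; apply/negP => lt; apply: h; exists n.
Qed.

Lemma N_cvg_ae : \forall w \ae P, cvg (N t w @[t --> +oo]).
Proof.
have hc := jet_cauchy_ae (atan_half_plane_jet (@ltr01 R) 0).
apply: filterS3 hc N_bounded_often (filterI M_mart.2 (filterI N_mart.2 M_cvg0)).
move=> w hc [K hK] [cM [cN M0]].
apply: (@atan_half_plane_cvg_unbounded _ (fun t => N t w) (fun t => M t w) K) => //.
apply: cvg_pinfty_dyadic => //.
exact: within_atan_half_plane.
Qed.

(** An upper limit along the integers is measurable whether or not the path converges; [fine] gives
    0 where it is infinite. *)
Definition N_limit (w : T) : R := fine (limn_esup (fun n => (N n%:R w)%:E)).

Lemma measurable_N_limit : measurable_fun setT N_limit.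
Proof.
apply: measurableT_comp => //; apply: measurable_fun_limn_esup => n.
exact/measurable_EFinP.
Qed.

Lemma cvg_nat_pinfty (f : R -> R) (l : R) :
  f t @[t --> +oo] --> l -> f n%:R @[n --> \oo] --> l.
Proof. by move=> fl; apply: (cvg_comp _ _ (@cvgr_idn R) fl). Qed.

Lemma N_limit_cvg : \forall w \ae P, N t w @[t --> +oo] --> N_limit w.
Proof.
apply: filterS N_cvg_ae => w /cvg_ex[l hl].
suff -> : N_limit w = l by [].
have h : (N n%:R w)%:E @[n --> \oo] --> l%:E.
  by apply: cvg_EFin; [exact: nearW|exact: cvg_nat_pinfty hl].
by rewrite /N_limit (cvg_limn_einf_sup h).
Qed.

HB.instance Definition _ := isMeasurableFun.Build _ _ _ _ N_limit
  measurable_N_limit.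

(** Bounded convergence in [n]: the expectations do not depend on [n], and the height [|M n| + e]
    tends to [e > 0]. *)
Lemma expect_atan_limit (e a : R) A : 0 < e -> F 0 A ->
  expect P (fun w => \1_A w * atan ((N_limit w - a) / e)) =
  expect P (fun w => \1_A w * atan (- a / (`|M 0 w| + e))).
Proof.
move=> e0 FA; have mA := filtration_measurable (lexx 0) FA.
have ml : measurable_fun setT (fun w => \1_A w * atan ((N_limit w - a) / e)).
  apply: measurable_funM => //; apply: measurableT_comp.
    by apply: continuous_measurable_fun => x; exact: continuous_atan.
  by apply: measurable_funM => //; exact: measurable_funB.
have bnd w (x : R) : `|\1_A w * atan x| <= pi / 2.
  by rewrite normrM -[leRHS]mul1r ler_pM// ?normr_indic// atan_bound.
have cv : expect P (fun w => \1_A w * atan_half_plane e a (N n%:R w) (M n%:R w))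
    @[n --> \oo] --> expect P (fun w => \1_A w * atan ((N_limit w - a) / e)).
  apply: (@expect_cvg _ _ _ _ _ _ (pi / 2)) => //.
  - by move=> n; apply: measurable_funM => //; exact: measurable_atan_hp.
  - by move=> n w; exact: bnd.
  have Nc := N_limit_cvg.
  apply: filterS2 Nc M_cvg0 => w /cvg_nat_pinfty Nw /cvg_nat_pinfty Mw.
  apply: cvgM; first exact: cvg_cst.
  have q : (N n%:R w - a) / (`|M n%:R w| + e) @[n --> \oo] -->
      (N_limit w - a) / (`|0 : R| + e).
    apply: cvgM; first by apply: cvgB => //; exact: cvg_cst.
    apply: cvgV; first by rewrite normr0 add0r gt_eqF.
    by apply: cvgD; [exact: cvg_norm|exact: cvg_cst].
  rewrite normr0 add0r in q.
  exact: (continuous_cvg _ (@continuous_atan R _) q).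
rewrite -(cvg_lim (@Rhausdorff R) cv); apply: cvg_lim => //.
under eq_fun => n do rewrite (expect_atan_hp a n e0 FA).
exact: cvg_cst.
Qed.

Lemma expect_tail (a : R) A : F 0 A ->
  expect P (fun w => \1_A w * half_line_sign a (N_limit w)) =
  expect P (fun w => \1_A w *
    (pi * fine (cauchy_law (M 0 w) `[a, +oo[%classic) - pi / 2)).
Proof.
move=> FA; have mA := filtration_measurable (lexx 0) FA.
have bnd w (x : R) : `|\1_A w * atan x| <= pi / 2.
  by rewrite normrM -[leRHS]mul1r ler_pM// ?normr_indic// atan_bound.
have cl : expect P (fun w =>
    \1_A w * atan ((N_limit w - level_shift a k) / height_shift R k))
    @[k --> \oo] --> expect P (fun w => \1_A w * half_line_sign a (N_limit w)).
  apply: (@expect_cvg _ _ _ _ _ _ (pi / 2)) => //.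
  - move=> k; apply: measurable_funM => //; apply: measurableT_comp.
      by apply: continuous_measurable_fun => x; exact: continuous_atan.
    by apply: measurable_funM => //; exact: measurable_funB.
  - apply: measurable_funM => //; apply: measurable_fun_ifT => //.
    exact: measurable_fun_ler.
  - by apply: aeW => w; apply: cvgM; [exact: cvg_cst|exact: atan_seq_cvg].
have cr : expect P (fun w =>
    \1_A w * atan (- level_shift a k / (`|M 0 w| + height_shift R k)))
    @[k --> \oo] --> expect P (fun w => \1_A w *
    (pi * fine (cauchy_law (M 0 w) `[a, +oo[%classic) - pi / 2)).
  apply: (@expect_cvg _ _ _ _ _ _ (pi / 2)) => //.
  - move=> k; apply: measurable_funM => //.
    exact: measurable_atan_init (height_shift_gt0 R k).
  - apply: measurable_funM => //; apply: measurable_funB => //.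
    apply: measurable_funM => //; apply: measurableT_comp => //.
    exact: (measurableT_comp (measurable_cauchy_law_tail a) (measurable_funPT (M 0))).
  - apply: filterS M_ge0 => w /(_ 0 (lexx _)) M0.
    apply: cvgM; first exact: cvg_cst.
    have := @atan_init_cvg R a (M 0 w).
    by rewrite (max_l M0) (ger0_norm M0).
rewrite -(cvg_lim (@Rhausdorff R) cl) -(cvg_lim (@Rhausdorff R) cr).
congr (limn _); apply/funext => k.
exact: expect_atan_limit (height_shift_gt0 R k) FA.
Qed.

(** [half_line_sign] is pi times an indicator minus pi / 2, so both sides of [expect_tail] contain
    the same constant part on [E]; cancelling it and dividing by pi leaves the tail identity. *)
Lemma cond_law_tail (a : R) A : measurable A ->
  P ((M 0 @^-1` A) `&` (N_limit @^-1` `[a, +oo[)) =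
  (\int[P]_(w in M 0 @^-1` A) cauchy_law (M 0 w) `[a, +oo[%classic)%E.
Proof.
move=> mA; set E := M 0 @^-1` A; set S := N_limit @^-1` _.
have FE : F 0 E.
  apply: (adapted_preimage (filtration_sigma (lexx 0))) => //.
  exact: (martingale_adapted M_mart.1).
have mE := filtration_measurable (lexx 0) FE.
have mS : measurable S by rewrite -[X in measurable X]setTI; exact: measurable_funPT.
pose k w := fine (cauchy_law (M 0 w) `[a, +oo[%classic).
have mk : measurable_fun setT k.
  apply: measurableT_comp => //.
  exact: (measurableT_comp (measurable_cauchy_law_tail a) (measurable_funPT (M 0))).
have kb w : `|k w| <= 1.
  rewrite ger0_norm /k ?fine_ge0// -lee_fin cauchy_law_tail_fin.
  by apply: cauchy_law_le1; exact: measurable_itv.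
have ki : intble P k by exact: (@intble_bounded _ _ _ _ _ 1).
have iE := intble_indic P mE; have iS := intble_indic P mS.
have iES : intble P (fun w => \1_E w * \1_S w) by exact: intble_indicM.
have iEk : intble P (fun w => \1_E w * k w) by exact: intble_indicM.
have := expect_tail a FE.
rewrite (eq_expect _ (g := fun w => pi * (\1_E w * \1_S w) - pi / 2 * \1_E w)); last first.
  move=> w; rewrite /half_line_sign [\1_S w]indicE.
  have -> : (w \in S) = (a <= N_limit w).
    by apply/idP/idP; rewrite inE /S /= in_itv/= andbT.
  by case: ifP => _ /=; lra.
rewrite expectB; [|exact: intbleZ|exact: intbleZ].
rewrite [RHS](eq_expect _ (g := fun w => pi * (\1_E w * k w) - pi / 2 * \1_E w)); last first.
  by move=> w; rewrite /k; ring.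
rewrite expectB; [|exact: intbleZ|exact: intbleZ].
move=> /addIr; rewrite !expectZ//.
move=> /(mulfI (lt0r_neq0 (pi_gt0 R))) Ek.
have -> : P (E `&` S) = (expect P (fun w => \1_E w * \1_S w))%:E.
  rewrite (_ : expect P _ = fine (P (E `&` S))).
    by rewrite fineP_fin//; exact: measurableI.
  rewrite -expect_indic; last exact: measurableI.
  by apply: eq_expect => w; rewrite indicI.
rewrite Ek expect_indicM// /Rintegral fineK.
  by apply: eq_integral => w _; exact: cauchy_law_tail_fin.
apply: integrable_fin_num => //.
exact: (integrableS measurableT mE (@subsetT _ _) ki).
Qed.

End half_plane_martingale.

Theorem proposition1p9 (d : measure_display) (T : measurableType d)
    (R : realType) (P : probability T R) (F : R -> set (set T))
    (M N QM QN QMN : R -> {RV P >-> R})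
    (F_filtration : is_filtration F)
    (M_martingale : is_continuous_martingale F M)
    (N_martingale : is_continuous_martingale F N)
    (QM_def : is_quadratic_variation M QM)
    (QN_def : is_quadratic_variation N QN)
    (QMN_def : is_quadratic_covariation M N QMN)
    (QM_eq_QN : \forall w \ae P, forall t, 0 <= t -> QM t w = QN t w)
    (QMN_eq0 : \forall w \ae P, forall t, 0 <= t -> QMN t w = 0)
    (M_ge0 : \forall w \ae P, forall t, 0 <= t -> 0 <= M t w)
    (M_cvg0 : \forall w \ae P, M t w @[t --> +oo] --> (0 : R))
    (N_0 : \forall w \ae P, N 0 w = 0) :
  exists Ninf : {RV P >-> R},
    (\forall w \ae P, N t w @[t --> +oo] --> Ninf w) /\
    is_cond_law (M 0) Ninf (@cauchy_law R).
Proof.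
pose Z : {RV P >-> R} := N_limit N.
exists Z; split.
  exact: (N_limit_cvg F_filtration M_martingale N_martingale QM_def QN_def
    QMN_def QM_eq_QN QMN_eq0 M_ge0 M_cvg0 N_0).
apply: cond_law_cauchy_of_tails; first exact: measurable_cauchy_law_tail.
move=> a A mA; exact: (cond_law_tail F_filtration M_martingale N_martingale
  QM_def QN_def QMN_def QM_eq_QN QMN_eq0 M_ge0 M_cvg0 N_0).
Qed.
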